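(* Let $X$ be a complex Banach space, $\tau>0$, let $A_{0}:\mathcal{D}(A_{0})\subseteq X\to X$ be the infinitesimal generator of a strongly continuous semigroup of bounded linear operators $\{\mathcal{T}(t)\}_{t\ge 0}$ on $X$, and let $A_{1}\in\mathcal{L}(X)$. Then there is a unique one-parameter family of bounded linear operators $\mathcal{S}(t;\tau)$, strongly continuous on $[-\tau,\infty)$, such that $\mathcal{S}(t;\tau)=\Theta$ for $-\tau\le t<0$ and $\mathcal{S}(0;\tau)=I$, strongly continuously differentiable on $[0,\infty)$ to $\mathcal{L}(X)$, and satisfying $$\frac{\mathrm{d}}{\mathrm{d}t}\mathcal{S}(t;\tau)=A_{0}\mathcal{S}(t;\tau)+A_{1}\mathcal{S}(t-\tau;\tau),\quad t\ge 0.$$ This solution has the explicit representation $$\mathcal{S}(t;\tau)=\sum_{n=0}^{\infty}S_{n}(t,n\tau)\,\mathbf{1}_{t\ge n\tau},\quad t\ge 0,$$ where $$S_{0}(t,0)=\mathcal{T}(t),\quad t\ge 0,$$ $$S_{n}(t,n\tau)=\int_{n\tau}^{t}\mathcal{T}(t-s)A_{1}S_{n-1}(s-\tau,(n-1)\tau)\,\mathrm{d}s,\quad t\ge n\tau,\ n\in\mathbb{N}.$$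
   Context: $\mathcal{L}(X)$ is the Banach algebra of bounded linear operators on $X$; $I$ and $\Theta$ are the identity and zero operators. $\mathbf{1}_{t\ge n\tau}$ equals $1$ if $t\ge n\tau$ and $0$ if $t<n\tau$. Integrals of operator-valued functions are taken in the strong operator topology.
   Formalization: Strong continuity is asked on [-τ,0) and [0,∞) separately (S jumps at 0); the derivative and equation are asked only for S(t)x with x in D(A0), with S(t)x in D(A0) for t≥0; C¹ is asked on [0,τ) and [τ,∞), with the right derivative at τ, where S' jumps. *)

(* Defs.v *)
From Stdlib Require Import Reals.
From Coquelicot Require Import Coquelicot.
Open Scope R_scope.

Set Implicit Arguments.
Unset Strict Implicit.

(* Restriction of scalars along RtoC.  Coquelicot differentiates and integrates
   functions of a real variable only with values in modules over R_AbsRing;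
   carrier, topology and norm of X are kept. *)
Section RealScalars.

Variable X : CompleteNormedModule C_AbsRing.

Lemma RtoC_scal_assoc (x y : R) (u : X) :
  scal (RtoC x) (scal (RtoC y) u) = scal (RtoC (x * y)) u.
Proof. now rewrite RtoC_mult, scal_assoc. Qed.

Lemma RtoC_scal_one (u : X) : scal (RtoC 1) u = u.
Proof. exact (scal_one u). Qed.

Lemma RtoC_scal_distr_l (x : R) (u v : X) :
  scal (RtoC x) (plus u v) = plus (scal (RtoC x) u) (scal (RtoC x) v).
Proof. exact (scal_distr_l (RtoC x) u v). Qed.

Lemma RtoC_scal_distr_r (x y : R) (u : X) :
  scal (RtoC (x + y)) u = plus (scal (RtoC x) u) (scal (RtoC y) u).
Proof. rewrite RtoC_plus. exact (scal_distr_r (RtoC x) (RtoC y) u). Qed.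

Definition real_ModuleSpace_mixin :
    ModuleSpace.mixin_of R_Ring (CompleteNormedModule.AbelianGroup _ X) :=
  @ModuleSpace.Mixin R_Ring (CompleteNormedModule.AbelianGroup _ X)
    (fun (r : R) (u : X) => scal (RtoC r) u)
    RtoC_scal_assoc RtoC_scal_one RtoC_scal_distr_l RtoC_scal_distr_r.

Definition real_NormedModuleAux_class : NormedModuleAux.class_of R_AbsRing X :=
  @NormedModuleAux.Class R_AbsRing X
    (@ModuleSpace.Class R_Ring X _ real_ModuleSpace_mixin)
    (UniformSpace.class (CompleteNormedModule.UniformSpace _ X)).

Lemma RtoC_norm_scal (r : R) (u : X) :
  norm (scal (RtoC r) u) <= Rabs r * norm u.
Proof. rewrite <- Cmod_R. exact (norm_scal (RtoC r) u). Qed.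

Definition real_NormedModule_mixin :
    NormedModule.mixin_of R_AbsRing
      (NormedModuleAux.Pack R_AbsRing X real_NormedModuleAux_class X) :=
  @NormedModule.Mixin R_AbsRing
    (NormedModuleAux.Pack R_AbsRing X real_NormedModuleAux_class X)
    (@norm _ X) (@norm_factor _ X)
    (@norm_triangle _ X) RtoC_norm_scal (@norm_compat1 _ X)
    (@norm_compat2 _ X) (@norm_eq_zero _ X).

Definition real_scalars : CompleteNormedModule R_AbsRing :=
  CompleteNormedModule.Pack R_AbsRing X
    (@CompleteNormedModule.Class R_AbsRing X
      (@NormedModule.Class R_AbsRing X _ real_NormedModule_mixin)
      (CompleteNormedModule.mixin _ X (CompleteNormedModule.class _ X)))
    X.

End RealScalars.

Section DelayEquation.

Variable X : CompleteNormedModule C_AbsRing.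

(* Elements of L(X) are the maps satisfying Coquelicot's is_linear, which
   includes boundedness.  Only the values T t with 0 <= t matter. *)
Record C0_semigroup (T : R -> X -> X) : Prop := {
  C0_bounded : forall t, 0 <= t -> is_linear (T t);
  C0_zero : forall x, T 0 x = x;
  C0_plus : forall s t x, 0 <= s -> 0 <= t -> T (s + t) x = T s (T t x);
  C0_continuous : forall x, continuous_on (fun t => 0 <= t) (fun t => T t x)
}.

Definition right_derivative_at_0 (T : R -> X -> X) (x y : X) : Prop :=
  filterlim (fun h : R => scal (RtoC (/ h)) (minus (T h x) x))
    (at_right 0) (locally y).

(* The unbounded operator A0 : D(A0) -> X is given by its domain D and a total
   function, of which only the values on D matter. *)
Record is_generator (T : R -> X -> X) (D : X -> Prop) (A0 : X -> X) : Prop := {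
  generator_domain : forall x, D x <-> exists y, right_derivative_at_0 T x y;
  generator_value : forall x, D x -> right_derivative_at_0 T x (A0 x)
}.

(* At an end point of the interval J the derivative is one-sided. *)
Definition C1_on (J : R -> Prop) (u du : R -> X) : Prop :=
  (forall t, J t ->
     filterdiff (V := real_scalars X) u (within J (locally t))
       (fun h : R => scal h (du t : real_scalars X)))
  /\ continuous_on J du.

(* The prescribed values jump from 0 to the identity at t = 0, so strong
   continuity is required on [-tau, 0) and on [0, +oo).  As A0 is unbounded,
   differentiability and the differential equation are required on the orbits
   starting in D(A0).  The term A1 S(t - tau) inherits the jump at t = tau,
   where S(.)x has two different one-sided derivatives in general; hence the
   splitting of [0, +oo) into [0, tau) and [tau, +oo).  The equation holds at
   every t >= 0, with the right derivative at t = 0 and t = tau. *)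
Record is_fundamental_solution (tau : R) (D : X -> Prop) (A0 A1 : X -> X)
    (S : R -> X -> X) : Prop := {
  fs_bounded : forall t, - tau <= t -> is_linear (S t);
  fs_history : forall t x, - tau <= t < 0 -> S t x = zero;
  fs_initial : forall x, S 0 x = x;
  fs_continuous_history :
    forall x, continuous_on (fun t => - tau <= t < 0) (fun t => S t x);
  fs_continuous : forall x, continuous_on (fun t => 0 <= t) (fun t => S t x);
  fs_domain : forall t x, 0 <= t -> D x -> D (S t x);
  fs_equation_before : forall x, D x ->
    C1_on (fun t => 0 <= t < tau) (fun t => S t x)
      (fun t => plus (A0 (S t x)) (A1 (S (t - tau) x)));
  fs_equation_after : forall x, D x ->
    C1_on (fun t => tau <= t) (fun t => S t x)
      (fun t => plus (A0 (S t x)) (A1 (S (t - tau) x)))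
}.

Section Terms.

Variables (tau : R) (T : R -> X -> X) (A1 : X -> X).

(* delay_term n t is S_n(t, n tau); it is meaningful for t >= n tau only. *)
Fixpoint delay_term (n : nat) (t : R) (x : X) : X :=
  match n with
  | O => T t x
  | S m => RInt (V := real_scalars X)
             (fun s => T (t - s) (A1 (delay_term m (s - tau) x)))
             (INR (S m) * tau) t
  end.

Definition truncated_delay_term (n : nat) (t : R) (x : X) : X :=
  if Rle_dec (INR n * tau) t then delay_term n t x else zero.

End Terms.

(* Convergence of a series in the operator norm. *)
Definition is_operator_series (a : nat -> X -> X) (L : X -> X) : Prop :=
  forall eps : posreal, exists N, forall n, (N <= n)%nat -> forall x,
    norm (minus (sum_n (fun k => a k x) n) (L x)) <= eps * norm x.

End DelayEquation.

(* Main.v *)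
Require Import Defs.
From Stdlib Require Import Reals Lra Lia List Classical ClassicalEpsilon.
From Coquelicot Require Import Coquelicot.
Open Scope R_scope.

(* S_n(t, n tau) = U_n(t - n tau), where U_0 = T and
   U_(n+1)(r) x = int_0^r T(r - q) A1 U_n(q) x dq are the Dyson-Phillips terms.
   For x in D(A0) each r |-> U_n(r) x is C^1 on [0, oo): by induction, since the
   convolution of T with a C^1 function f is C^1 with values in D(A0) and
   solves v' = A0 v + f.  As U_n(0) = 0 for n >= 1 and U_n'(0) = 0 for n >= 2,
   the terms switched on at n tau, n >= 2, are C^1 across n tau, so the
   (locally finite) sum is C^1 on [tau, oo).
   Uniqueness: the difference u of two solutions satisfies u' = A0 u on
   successive intervals of length tau, so that s |-> T(b - s) u(s) is constant;
   D(A0) is dense.  Only right derivatives are computed: a continuous function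
   is determined by its right derivative. *)

(** * Linear identities in real modules *)

(** Strong continuity bounds each orbit separately, whereas estimates of [T (r - q) (f q)] under an
    integral need one bound on a compact time interval; hence uniform boundedness, obtained from
    shrinking balls. Outside D(A0) orbits need not be differentiable, so the equation is treated on
    D(A0), and density with boundedness carries uniqueness to X. The term n = 1 is the exception to
    smooth switching: U_1'(0) = A1 x, which is the kink at tau. Right derivatives suit semigroups
    because T(h) is given only for h >= 0; a continuous function with continuous right derivative w
    is a primitive of w, and this gives back the required differentials. The analysis runs over real
    scalars; complex homogeneity is regained because the construction commutes with every bounded
    map that commutes with T and A1. Clamping time at 0 makes the integrands continuous on the whole
    line and U_n zero before its switching time for n >= 1, so the sum is written without
    indicators. *)

Section ModuleExpressions.

Variable V : ModuleSpace R_Ring.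

Inductive mexp : Type :=
| mvar (n : nat)
| mzero
| mplus (e f : mexp)
| mopp (e : mexp)
| mscal (r : R) (e : mexp).

Fixpoint meval (l : list V) (e : mexp) : V :=
  match e with
  | mvar n => nth n l zero
  | mzero => zero
  | mplus e f => plus (meval l e) (meval l f)
  | mopp e => opp (meval l e)
  | mscal r e => scal r (meval l e)
  end.

Fixpoint mcoef (e : mexp) (i : nat) : R :=
  match e with
  | mvar n => if Nat.eqb i n then 1 else 0
  | mzero => 0
  | mplus e f => mcoef e i + mcoef f i
  | mopp e => - mcoef e i
  | mscal r e => r * mcoef e i
  end.

Fixpoint lincomb (c : nat -> R) (l : list V) : V :=
  match l with
  | nil => zero
  | x :: l => plus (scal (c 0%nat) x) (lincomb (fun i => c (Datatypes.S i)) l)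
  end.

(** Compares only indices below the length of [l], so for a concrete list it unfolds to a finite
    conjunction of equations between reals. *)
Fixpoint same_coefs (c d : nat -> R) (l : list V) : Prop :=
  match l with
  | nil => True
  | x :: l => c 0%nat = d 0%nat /\
      same_coefs (fun i => c (Datatypes.S i)) (fun i => d (Datatypes.S i)) l
  end.

Lemma lincomb_same (l : list V) (c d : nat -> R) :
  same_coefs c d l -> lincomb c l = lincomb d l.
Proof.
revert c d; induction l as [|x l IH]; intros c d; simpl; [easy|].
intros [H1 H2]; now rewrite H1, (IH _ _ H2).
Qed.

Lemma lincomb_zero (l : list V) : lincomb (fun _ => 0) l = zero.
Proof.
induction l as [|x l IH]; simpl; [easy|].
rewrite IH, plus_zero_r. exact (scal_zero_l x).
Qed.

Lemma lincomb_var (l : list V) (n : nat) :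
  lincomb (fun i => if Nat.eqb i n then 1 else 0) l = nth n l zero.
Proof.
revert n; induction l as [|x l IH]; intros [|n]; simpl; try easy.
- rewrite lincomb_zero, plus_zero_r. exact (scal_one x).
- rewrite IH. rewrite (scal_zero_l x : scal 0 x = zero). apply plus_zero_l.
Qed.

Lemma lincomb_plus (l : list V) (c d : nat -> R) :
  lincomb (fun i => c i + d i) l = plus (lincomb c l) (lincomb d l).
Proof.
revert c d; induction l as [|x l IH]; intros c d; simpl.
- now rewrite plus_zero_l.
- rewrite (IH (fun i => c (Datatypes.S i)) (fun i => d (Datatypes.S i))).
  rewrite (scal_distr_r (c 0%nat) (d 0%nat) x : scal (c 0%nat + d 0%nat) x = _).
  rewrite <- 2!plus_assoc. f_equal. rewrite 2!plus_assoc. f_equal.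
  apply plus_comm.
Qed.

Lemma lincomb_scal (l : list V) (r : R) (c : nat -> R) :
  lincomb (fun i => r * c i) l = scal r (lincomb c l).
Proof.
revert c; induction l as [|x l IH]; intros c; simpl.
- now rewrite scal_zero_r.
- rewrite (IH (fun i => c (Datatypes.S i))), scal_distr_l, scal_assoc.
  reflexivity.
Qed.

Lemma meval_lincomb (l : list V) (e : mexp) :
  meval l e = lincomb (mcoef e) l.
Proof.
induction e as [n| |e IHe f IHf|e IHe|r e IHe]; simpl.
- symmetry; apply lincomb_var.
- symmetry; apply lincomb_zero.
- rewrite IHe, IHf. symmetry; apply (lincomb_plus l (mcoef e) (mcoef f)).
- rewrite IHe, <- scal_opp_one.
  transitivity (lincomb (fun i => - (1) * mcoef e i) l).
  + symmetry; exact (lincomb_scal l (- (1)) (mcoef e)).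
  (* The two coefficient functions agree only pointwise, hence an induction on the list. *)
  + generalize (mcoef e). clear.
    induction l as [|x l IH]; intros c; simpl; [easy|].
    rewrite (IH (fun i => c (Datatypes.S i))). do 2 f_equal. ring.
- rewrite IHe. symmetry; apply lincomb_scal.
Qed.

Lemma meval_eq (l : list V) (e f : mexp) :
  same_coefs (mcoef e) (mcoef f) l -> meval l e = meval l f.
Proof. rewrite 2!meval_lincomb. apply lincomb_same. Qed.

End ModuleExpressions.

Ltac madd_var x l :=
  lazymatch l with
  | context [cons x _] => l
  | _ => constr:(cons x l)
  end.

Ltac mvars t l :=
  lazymatch t with
  | plus ?a ?b => let l := mvars a l in mvars b l
  | minus ?a ?b => let l := mvars a l in mvars b l
  | opp ?a => mvars a l
  | scal _ ?a => mvars a l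
  | zero => l
  | _ => madd_var t l
  end.

Ltac mindex x l :=
  lazymatch l with
  | cons x _ => constr:(0%nat)
  | cons _ ?l => let n := mindex x l in constr:(Datatypes.S n)
  end.

Ltac mreify t l :=
  lazymatch t with
  | plus ?a ?b =>
      let a := mreify a l in let b := mreify b l in constr:(mplus a b)
  | minus ?a ?b =>
      let a := mreify a l in let b := mreify b l in constr:(mplus a (mopp b))
  | opp ?a => let a := mreify a l in constr:(mopp a)
  | scal ?r ?a => let a := mreify a l in constr:(mscal r a)
  | zero => constr:(mzero)
  | _ => let n := mindex t l in constr:(mvar n)
  end.

(* Reduces an identity between linear combinations to the equality of the
   coefficients of every atom. *)
Ltac module_coefs :=
  cbv beta;
  lazymatch goal with
  | |- @eq ?U ?a ?b =>
      let V := lazymatch U with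
               | CompleteNormedModule.sort _ ?W =>
                   constr:(CompleteNormedModule.ModuleSpace _ W : ModuleSpace R_Ring)
               | _ => lazymatch goal with
                 | W : CompleteNormedModule R_AbsRing |- _ =>
                   constr:(CompleteNormedModule.ModuleSpace _ W : ModuleSpace R_Ring)
                 end
               end in
      let l := mvars a (@nil (ModuleSpace.sort _ V)) in
      let l := mvars b l in
      let e := mreify a l in
      let f := mreify b l in
      change (@meval V l e = @meval V l f);
      apply meval_eq; cbn [same_coefs mcoef Nat.eqb]
  end.

Ltac module_eq :=
  module_coefs; repeat split;
  try (cbv [minus plus opp scal one zero mult]; cbn; first [ring | field; lra]).

(** * Integrals and right derivatives *)

Section RealAnalysis.

Context {V : CompleteNormedModule R_AbsRing}.
Implicit Types (u v w : R -> V) (x y z : V) (a b t h : R).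

(* Coquelicot's lemmas restated for a complete space, so that the inferred
   structures agree and the equations can be used for rewriting. *)
Section LinearMaps.

Variables (L : V -> V).
Hypothesis HL : is_linear L.

Lemma lin_plus x y : L (plus x y) = plus (L x) (L y).
Proof using HL. exact (linear_plus L HL x y). Qed.

Lemma lin_scal (r : R) x : L (scal r x) = scal r (L x).
Proof using HL. exact (linear_scal L HL r x). Qed.

Lemma lin_opp x : L (opp x) = opp (L x).
Proof using HL. exact (linear_opp L x HL). Qed.

Lemma lin_minus x y : L (minus x y) = minus (L x) (L y).
Proof using HL. exact (linear_minus L x y HL). Qed.

Lemma lin_zero : L zero = zero.
Proof using HL. exact (linear_zero L HL). Qed.

End LinearMaps.

(** * Norm inequalities *)

Lemma norm_plus_le x y : norm (plus x y) <= norm x + norm y.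
Proof. exact (@norm_triangle _ V x y). Qed.

Lemma norm_neg x : norm (opp x : V) = norm x.
Proof. exact (@norm_opp _ V x). Qed.

Lemma norm_minus_le x y : norm (minus x y) <= norm x + norm y.
Proof.
unfold minus. rewrite <- (norm_opp y). apply norm_plus_le.
Qed.

Lemma norm_scal_le (r : R) x : norm (scal r x) <= Rabs r * norm x.
Proof. exact (@norm_scal _ V r x). Qed.

(** Normed modules postulate only [<=]; the reverse inequality is the postulate applied to the
    factor [/ r]. *)
Lemma norm_scal_pos (r : R) x : 0 < r -> norm (scal r x) = r * norm x.
Proof.
intros Hr. apply Rle_antisym.
{ eapply Rle_trans; [apply norm_scal_le|]. rewrite Rabs_right; lra. }
assert (H : norm x <= / r * norm (scal r x)).
{ replace x with (scal (/ r) (scal r x)) at 1 by module_eq.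
  eapply Rle_trans; [apply norm_scal_le|].
  rewrite (Rabs_right (/ r)) by (left; now apply Rinv_0_lt_compat).
  apply Rle_refl. }
apply (Rmult_le_compat_l r) in H; [|lra].
replace (r * (/ r * norm (scal r x))) with (norm (scal r x)) in H by (field; lra).
exact H.
Qed.

Lemma norm_of_zero x : x = zero -> norm x = 0.
Proof. intros ->. exact (@norm_zero _ V). Qed.

Lemma norm_minus_self x : norm (minus x x) = 0.
Proof. apply norm_of_zero. module_eq. Qed.

Lemma norm_minus_sym x y : norm (minus x y) = norm (minus y x).
Proof. rewrite <- norm_opp, opp_minus. reflexivity. Qed.

Lemma norm_minus_triangle y x z :
  norm (minus x z) <= norm (minus x y) + norm (minus y z).
Proof.
replace (minus x z) with (plus (minus x y) (minus y z)) by module_eq.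
apply norm_plus_le.
Qed.

Lemma minus_plus_cancel x y : x = plus (minus x y) y.
Proof. module_eq. Qed.

Lemma eq_of_norm_le_eps x y :
  (forall eps, 0 < eps -> norm (minus x y) <= eps) -> x = y.
Proof.
intros H.
assert (H0 : norm (minus x y) = 0).
{ apply Rle_antisym; [|apply norm_ge_0].
  apply Rnot_lt_le; intros H1.
  specialize (H (norm (minus x y) / 2)). lra. }
apply norm_eq_zero in H0.
rewrite (minus_plus_cancel x y), H0. apply plus_zero_l.
Qed.

(** * Continuity in terms of the norm *)

Lemma continuous_eps u t :
  continuous u t <->
  forall eps, 0 < eps -> exists delta, 0 < delta /\
    forall s, Rabs (s - t) < delta -> norm (minus (u s) (u t)) < eps.
Proof.
split; intros H.
- intros eps Heps.
  destruct (proj1 (filterlim_locally_ball_norm u (u t)) H (mkposreal eps Heps))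
    as [d Hd].
  exists d. split; [apply cond_pos|]. intros s Hs. apply (Hd s Hs).
- apply (proj2 (filterlim_locally_ball_norm u (u t))).
  intros eps. destruct (H eps (cond_pos eps)) as [d [Hd Hd']].
  exists (mkposreal d Hd). intros s Hs. apply (Hd' s Hs).
Qed.

Lemma continuous_on_eps (J : R -> Prop) u :
  continuous_on J u <->
  forall t, J t -> forall eps, 0 < eps -> exists delta, 0 < delta /\
    forall s, J s -> Rabs (s - t) < delta -> norm (minus (u s) (u t)) < eps.
Proof.
split; intros H t Ht.
- pose proof (proj1 (filterlim_locally_ball_norm u (u t)) (H t Ht)) as H1.
  intros eps Heps. destruct (H1 (mkposreal eps Heps)) as [d Hd].
  exists d. split; [apply cond_pos|]. intros s Js Hs. apply (Hd s Hs Js).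
- apply (proj2 (filterlim_locally_ball_norm u (u t))).
  intros eps. destruct (H t Ht eps (cond_pos eps)) as [d [Hd Hd']].
  exists (mkposreal d Hd). intros s Hs Js. apply (Hd' s Js Hs).
Qed.

Lemma Rabs_Rmax_le a s t : Rabs (Rmax a s - Rmax a t) <= Rabs (s - t).
Proof.
unfold Rmax; destruct (Rle_dec a s), (Rle_dec a t);
  unfold Rabs; repeat destruct Rcase_abs; lra.
Qed.

(** [Rmax a] is 1-Lipschitz with values in [[a, oo)], so composing with it turns one-sided
    continuity at [a] into continuity on the line. *)
Lemma continuous_on_clamp a u :
  continuous_on (fun t => a <= t) u -> forall t, continuous (fun s : R => u (Rmax a s)) t.
Proof.
rewrite continuous_on_eps. intros H t. apply continuous_eps. intros eps Heps.
destruct (H (Rmax a t) (Rmax_l _ _) eps Heps) as [d [Hd Hd']].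
exists d. split; [easy|]. intros s Hs.
apply Hd'; [apply Rmax_l|]. eapply Rle_lt_trans; [apply Rabs_Rmax_le|easy].
Qed.

Lemma continuous_on_of_continuous (J : R -> Prop) u :
  (forall t, J t -> continuous u t) -> continuous_on J u.
Proof.
intros H. apply continuous_on_eps. intros t Ht eps Heps.
destruct (proj1 (continuous_eps _ _) (H t Ht) eps Heps) as [d [Hd Hd']].
exists d; split; [easy|]. auto.
Qed.

Lemma continuous_shift u c t :
  continuous u (t + c) -> continuous (fun s : R => u (s + c)) t.
Proof.
rewrite 2!continuous_eps. intros H eps Heps.
destruct (H eps Heps) as [d [Hd Hd']]. exists d; split; [easy|].
intros s Hs. apply Hd'. now replace (s + c - (t + c)) with (s - t) by ring.
Qed.

(** * Integrals of continuous functions *)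

Lemma ex_RInt_cont u a b : (forall t, continuous u t) -> ex_RInt u a b.
Proof. intros H; apply (ex_RInt_continuous u); auto. Qed.

Lemma norm_RInt_cont_le u a b (M : R) :
  (forall t, continuous u t) -> a <= b ->
  (forall t, a <= t <= b -> norm (u t) <= M) -> norm (RInt u a b) <= (b - a) * M.
Proof.
intros Hu Hab HM. apply (norm_RInt_le_const u a b); [easy|easy|].
apply RInt_correct. now apply ex_RInt_cont.
Qed.

Lemma norm_RInt_minus_const_le u a b z (eps : R) :
  (forall t, continuous u t) -> a <= b ->
  (forall t, a <= t <= b -> norm (minus (u t) z) <= eps) ->
  norm (minus (RInt u a b) (scal (b - a) z)) <= (b - a) * eps.
Proof.
intros Hu Hab H.
rewrite <- (RInt_const a b z), <- RInt_minus;
  [|now apply ex_RInt_cont|apply ex_RInt_const].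
apply norm_RInt_cont_le; [|easy|easy].
intros t. apply (continuous_minus u (fun _ => z)); [easy|apply continuous_const].
Qed.

Lemma RInt_cont_Chasles u a b c :
  (forall t, continuous u t) -> plus (RInt u a b) (RInt u b c) = RInt u a c.
Proof. intros H. apply RInt_Chasles; now apply ex_RInt_cont. Qed.

Lemma RInt_cont_minus u v a b :
  (forall t, continuous u t) -> (forall t, continuous v t) ->
  RInt (fun s => minus (u s) (v s)) a b = minus (RInt u a b) (RInt v a b).
Proof. intros Hu Hv. apply (RInt_minus u v); now apply ex_RInt_cont. Qed.

Lemma RInt_cont_plus u v a b :
  (forall t, continuous u t) -> (forall t, continuous v t) ->
  RInt (fun s => plus (u s) (v s)) a b = plus (RInt u a b) (RInt v a b).
Proof. intros Hu Hv. apply (RInt_plus u v); now apply ex_RInt_cont. Qed.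

Lemma RInt_cont_scal u (r : R) a b :
  (forall t, continuous u t) ->
  RInt (fun s => scal r (u s)) a b = scal r (RInt u a b).
Proof. intros Hu. apply (RInt_scal u); now apply ex_RInt_cont. Qed.

(** [L] commutes with every Riemann sum, and its continuity passes this to the limit. *)
Lemma is_RInt_linear (L : V -> V) u a b z :
  is_linear L -> is_RInt u a b z -> is_RInt (fun s => L (u s)) a b (L z).
Proof.
intros HL H. unfold is_RInt in *.
apply filterlim_ext with
  (fun ptd => L (scal (sign (b - a)) (Riemann_sum u ptd))).
{ intros ptd. rewrite (linear_scal L HL). f_equal.
  apply SF_cons_ind with (s := ptd).
  - intros x0. exact (linear_zero L HL).
  - intros h0 s IH. rewrite 2!Riemann_sum_cons, (linear_plus L HL), IH. f_equal.
    apply (linear_scal L HL). }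
apply filterlim_comp with (1 := H). exact (linear_cont L z HL).
Qed.

Lemma RInt_linear (L : V -> V) u a b :
  is_linear L -> ex_RInt u a b -> RInt (fun s => L (u s)) a b = L (RInt u a b).
Proof.
intros HL H. apply is_RInt_unique, is_RInt_linear; [easy|].
now apply RInt_correct.
Qed.

Lemma RInt_shift u c a b :
  (forall t, continuous u t) ->
  RInt (fun s => u (s + c)) a b = RInt u (a + c) (b + c).
Proof.
intros Hu. replace (a + c) with (1 * a + c) by ring.
replace (b + c) with (1 * b + c) by ring.
rewrite <- (RInt_comp_lin u 1 c a b); [|now apply ex_RInt_cont].
apply RInt_ext. intros s _. rewrite Rmult_1_l. symmetry. exact (scal_one _).
Qed.

(** Free of quotients: the errors of several functions add up as multiples of [h], and a bounded map
    acts on them directly. *)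
Definition right_deriv u t y : Prop :=
  forall eps, 0 < eps -> exists delta, 0 < delta /\ forall h, 0 < h < delta ->
    norm (minus (minus (u (t + h)) (u t)) (scal h y)) <= eps * h.

Lemma right_deriv_plus u v t y z :
  right_deriv u t y -> right_deriv v t z ->
  right_deriv (fun s => plus (u s) (v s)) t (plus y z).
Proof.
intros Hu Hv eps Heps.
destruct (Hu (eps / 2) ltac:(lra)) as [d1 [Hd1 H1]].
destruct (Hv (eps / 2) ltac:(lra)) as [d2 [Hd2 H2]].
exists (Rmin d1 d2). split; [now apply Rmin_pos|]. intros h Hh.
assert (h < d1 /\ h < d2).
{ generalize (Rmin_l d1 d2) (Rmin_r d1 d2); lra. }
specialize (H1 h ltac:(lra)). specialize (H2 h ltac:(lra)).
replace (minus _ _) with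
  (plus (minus (minus (u (t + h)) (u t)) (scal h y))
        (minus (minus (v (t + h)) (v t)) (scal h z))) by module_eq.
eapply Rle_trans; [apply norm_plus_le|]. lra.
Qed.

Lemma right_deriv_linear (L : V -> V) u t y :
  is_linear L -> right_deriv u t y -> right_deriv (fun s => L (u s)) t (L y).
Proof.
intros HL Hu eps Heps. destruct (linear_norm L HL) as [M [HM HLM]].
destruct (Hu (eps / M) ltac:(now apply Rdiv_lt_0_compat)) as [d [Hd H]].
exists d; split; [easy|]. intros h Hh.
rewrite <- (linear_scal L HL), <- 2!(linear_minus L _ _ HL).
eapply Rle_trans; [apply HLM|].
replace (eps * h) with (M * (eps / M * h)) by (field; lra).
apply Rmult_le_compat_l; [lra|auto].
Qed.

Lemma right_deriv_minus u v t y z :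
  right_deriv u t y -> right_deriv v t z ->
  right_deriv (fun s => minus (u s) (v s)) t (minus y z).
Proof.
intros Hu Hv. apply (right_deriv_plus u (fun s => opp (v s))); [easy|].
apply right_deriv_linear; [exact (@is_linear_opp _ V)|easy].
Qed.

Lemma right_deriv_ext u v t y d :
  0 < d -> (forall s, t <= s < t + d -> u s = v s) ->
  right_deriv u t y -> right_deriv v t y.
Proof.
intros Hd Huv Hu eps Heps. destruct (Hu eps Heps) as [d' [Hd' H]].
exists (Rmin d d'). split; [now apply Rmin_pos|]. intros h Hh.
assert (h < d /\ h < d').
{ generalize (Rmin_l d d') (Rmin_r d d'); lra. }
rewrite <- 2!Huv by lra. apply H; lra.
Qed.

Lemma right_deriv_const z t : right_deriv (fun _ => z) t zero.
Proof.
intros eps Heps. exists 1. split; [lra|]. intros h Hh.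
rewrite norm_of_zero by module_eq. apply Rmult_le_pos; lra.
Qed.

Lemma right_deriv_shift u c t y :
  right_deriv u (t + c) y -> right_deriv (fun s => u (s + c)) t y.
Proof.
intros H eps Heps. destruct (H eps Heps) as [d [Hd H1]].
exists d; split; [easy|]. intros h Hh.
replace (t + h + c) with (t + c + h) by ring. auto.
Qed.

Lemma right_deriv_unique u t y z :
  right_deriv u t y -> right_deriv u t z -> y = z.
Proof.
intros Hy Hz. apply eq_of_norm_le_eps. intros eps Heps.
destruct (Hy (eps / 2) ltac:(lra)) as [d1 [Hd1 H1]].
destruct (Hz (eps / 2) ltac:(lra)) as [d2 [Hd2 H2]].
set (h := Rmin d1 d2 / 2).
assert (Hh : 0 < h) by (generalize (Rmin_pos d1 d2); unfold h; lra).
assert (h < d1 /\ h < d2).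
{ generalize (Rmin_l d1 d2) (Rmin_r d1 d2); unfold h in *; lra. }
specialize (H1 h ltac:(lra)). specialize (H2 h ltac:(lra)).
apply Rmult_le_reg_l with (1 := Hh).
apply Rle_trans with (norm (scal h (minus y z))).
{ rewrite norm_scal_pos; lra. }
replace (scal h (minus y z)) with
  (minus (minus (minus (u (t + h)) (u t)) (scal h z))
         (minus (minus (u (t + h)) (u t)) (scal h y))) by module_eq.
eapply Rle_trans; [apply norm_minus_le|]. lra.
Qed.

Lemma right_deriv_RInt w a t :
  (forall s, continuous w s) -> right_deriv (fun s => RInt w a s) t (w t).
Proof.
intros Hw eps Heps.
destruct (proj1 (continuous_eps _ _) (Hw t) eps Heps) as [d [Hd H]].
exists d; split; [easy|]. intros h Hh.
rewrite <- (RInt_cont_Chasles w a t (t + h) Hw).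
replace (minus _ _) with (minus (RInt w t (t + h)) (scal (t + h - t) (w t)))
  by module_eq.
replace (eps * h) with ((t + h - t) * eps) by ring.
apply norm_RInt_minus_const_le; [easy|lra|].
intros s Hs. left. apply H. apply Rabs_def1; lra.
Qed.

(** Real induction: the points up to which the bound holds form an interval that is closed by
    continuity and extends to the right by the derivative hypothesis, so its supremum is [b]. *)
Lemma right_deriv_zero_le u a b (eps : R) :
  0 < eps -> a <= b -> (forall t, a <= t <= b -> continuous u t) ->
  (forall t, a <= t < b -> right_deriv u t zero) ->
  norm (minus (u b) (u a)) <= eps * (b - a).
Proof.
intros Heps Hab Hu Hd.
set (E := fun t => a <= t <= b /\
  forall s, a <= s <= t -> norm (minus (u s) (u a)) <= eps * (s - a)).
assert (Ea : E a).
{ split; [lra|]. intros s Hs. replace s with a by lra.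
  rewrite norm_minus_self. lra. }
destruct (completeness E) as [c [Hc1 Hc2]].
{ exists b. intros t [Ht _]; lra. }
{ now exists a. }
assert (Hac : a <= c) by auto.
assert (Hcb : c <= b) by (apply Hc2; intros t [Ht _]; lra).
assert (Hlt : forall s, a <= s < c -> norm (minus (u s) (u a)) <= eps * (s - a)).
{ intros s Hs. apply NNPP. intros Hn.
  assert (Hcs : c <= s); [|lra].
  apply Hc2. intros t [Ht Et]. apply Rnot_lt_le. intros Hst.
  apply Hn, Et. lra. }
assert (Ec : E c).
{ split; [lra|]. intros s Hs.
  destruct (Rlt_le_dec s c) as [H|H]; [apply Hlt; lra|].
  replace s with c by lra.
  destruct (Req_dec a c) as [<-|Hne]; [apply Ea; lra|].
  apply le_epsilon. intros eta Heta.
  destruct (proj1 (continuous_eps _ _) (Hu c ltac:(lra)) eta Heta) as [d [Hd0 H1]].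
  (* A point left of [c] that is close enough for continuity and still in [[a, c)], where the bound
     is known. *)
  set (s' := Rmax a (c - d / 2)).
  assert (Hs' : a <= s' < c /\ c - s' < d).
  { unfold s', Rmax; destruct Rle_dec; lra. }
  eapply Rle_trans; [apply (norm_minus_triangle (u s'))|].
  rewrite norm_minus_sym.
  specialize (H1 s' ltac:(apply Rabs_def1; lra)).
  specialize (Hlt s' ltac:(lra)).
  assert (eps * (s' - a) <= eps * (c - a)) by (apply Rmult_le_compat_l; lra).
  lra. }
destruct (Rlt_le_dec c b) as [Hlt'|Hge]; [exfalso|].
- destruct (Hd c ltac:(lra) eps Heps) as [d [Hd0 H1]].
  set (c' := c + Rmin d (b - c) / 2).
  assert (Hc' : c < c' /\ c' <= b /\ c' - c < d).
  { unfold c'. generalize (Rmin_pos d (b - c)) (Rmin_l d (b - c)) (Rmin_r d (b - c)).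
    lra. }
  assert (E c'); [|generalize (Hc1 c' H); lra].
  split; [lra|]. intros s Hs.
  destruct (Rle_lt_dec s c) as [H|H]; [apply Ec; lra|].
  eapply Rle_trans; [apply (norm_minus_triangle (u c))|].
  assert (H2 : norm (minus (u s) (u c)) <= eps * (s - c)).
  { eapply Rle_trans; [|apply (H1 (s - c)); lra].
    replace (c + (s - c)) with s by ring. right. f_equal. module_eq. }
  generalize (proj2 Ec c ltac:(lra)). lra.
- replace b with c by lra. apply Ec. lra.
Qed.

Lemma right_deriv_zero_const u a b :
  a <= b -> (forall t, a <= t <= b -> continuous u t) ->
  (forall t, a <= t < b -> right_deriv u t zero) -> u b = u a.
Proof.
intros Hab Hu Hd. apply eq_of_norm_le_eps. intros eps Heps.
(* The summand 1 keeps the divisor positive when [a = b]. *)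
assert (Hpos : 0 < eps / (b - a + 1)) by (apply Rdiv_lt_0_compat; lra).
eapply Rle_trans; [now apply (right_deriv_zero_le u a b _ Hpos)|].
apply Rle_trans with (eps / (b - a + 1) * (b - a + 1)).
- apply Rmult_le_compat_l; lra.
- right. field. lra.
Qed.

Lemma continuous_RInt_upper w a t :
  (forall s, continuous w s) -> continuous (fun s : R => RInt w a s) t.
Proof.
intros Hw. apply (@continuous_RInt_1 V w a t (fun s => RInt w a s)).
apply filter_forall. intros s. now apply RInt_correct, ex_RInt_cont.
Qed.

(** The difference of [u] and the primitive of [w] has right derivative zero. This is how a right
    derivative recovers the function. *)
Lemma minus_eq_RInt u w a b :
  a <= b -> (forall t, a <= t <= b -> continuous u t) ->
  (forall t, continuous w t) ->
  (forall t, a <= t < b -> right_deriv u t (w t)) ->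
  minus (u b) (u a) = RInt w a b.
Proof.
intros Hab Hu Hw Hd.
assert (H : minus (u b) (RInt w a b) = minus (u a) (RInt w a a)).
{ apply (right_deriv_zero_const (fun t => minus (u t) (RInt w a t)) a b Hab).
  - intros t Ht. apply (continuous_minus u); [auto|now apply continuous_RInt_upper].
  - intros t Ht. replace (zero : V) with (minus (w t) (w t)) by module_eq.
    apply right_deriv_minus; [auto|now apply right_deriv_RInt]. }
rewrite RInt_point in H.
replace (minus (u b) (u a)) with
  (plus (minus (minus (u b) (RInt w a b)) (minus (u a) zero)) (RInt w a b)) by module_eq.
rewrite H. module_eq.
Qed.

End RealAnalysis.

(** * Uniform boundedness *)

Section Completeness.

Context {V : CompleteNormedModule R_AbsRing}.
Implicit Types (x y z : V).

(** The Cauchy bound [r n] survives in the limit, so for nested closed balls with radii [r n] the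
    limit lies in each of them. *)
Lemma cauchy_limit (y : nat -> V) (r : nat -> R) :
  (forall n m, (n <= m)%nat -> norm (minus (y m) (y n)) <= r n) ->
  (forall eps, 0 < eps -> exists n, r n < eps) ->
  exists x, forall n, norm (minus x (y n)) <= r n.
Proof.
intros Hy Hr.
destruct (proj1 (filterlim_locally_cauchy (F := eventually) y)) as [x Hx].
{ intros eps. destruct (Hr (eps / 2)) as [N HN].
  { generalize (cond_pos eps); lra. }
  exists (fun m => (N <= m)%nat). split; [now exists N|].
  intros k m Hk Hm. apply (@norm_compat1 _ V).
  eapply Rle_lt_trans; [apply (norm_minus_triangle (y N))|].
  rewrite (norm_minus_sym (y N)).
  generalize (Hy N k Hk) (Hy N m Hm); lra. }
exists x. intros n. apply le_epsilon. intros eps Heps.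
destruct (proj1 (filterlim_locally_ball_norm (F := eventually) y x) Hx
  (mkposreal eps Heps)) as [N HN].
set (m := Nat.max n N).
specialize (HN m ltac:(unfold m; lia)).
specialize (Hy n m ltac:(unfold m; lia)).
change (norm (minus (y m) x) < eps) in HN.
eapply Rle_trans; [apply (norm_minus_triangle (y m))|].
rewrite norm_minus_sym. lra.
Qed.

Section UniformBoundedness.

Variables (I : Type) (F : I -> V -> V).
Hypothesis F_linear : forall i, is_linear (F i).
Hypothesis F_unbounded :
  forall M, 0 < M -> exists i x, M * norm x < norm (F i x).

(** The images of [y + z] and [y - z] differ by [2 F i z], so both cannot be small when [F i z] is
    large. This puts large values near any [y]. *)
Lemma unbounded_near (y : V) (r K : R) :
  0 < r -> 0 < K -> exists i z, norm z <= r /\ K < norm (F i (plus y z)).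
Proof using F_linear F_unbounded.
intros Hr HK.
destruct (F_unbounded (K / r)) as [i [x Hx]]; [now apply Rdiv_lt_0_compat|].
assert (Hx0 : 0 < norm x).
{ destruct (Rle_lt_or_eq_dec 0 (norm x) (norm_ge_0 x)) as [H|H]; [easy|].
  rewrite <- H in Hx. symmetry in H. apply norm_eq_zero in H.
  rewrite (norm_of_zero (F i x)) in Hx; [lra|].
  rewrite H. exact (linear_zero _ (F_linear i)). }
set (z := scal (r / norm x) x).
assert (Hc : 0 < r / norm x) by now apply Rdiv_lt_0_compat.
assert (Hz : norm z = r).
{ unfold z. rewrite norm_scal_pos by easy. field. lra. }
assert (HFz : K < norm (F i z)).
{ unfold z. rewrite (lin_scal _ (F_linear i)), norm_scal_pos by easy.
  apply Rmult_lt_compat_l with (r := r / norm x) in Hx; [|easy].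
  replace (r / norm x * (K / r * norm x)) with K in Hx by (field; lra). easy. }
exists i.
destruct (Rlt_le_dec K (norm (F i (plus y z)))) as [H|H].
{ exists z; lra. }
exists (opp z). split; [right; exact (eq_trans (norm_neg z) Hz)|].
assert (H2 : 2 * norm (F i z) <= norm (F i (plus y z)) + norm (F i (plus y (opp z)))).
{ rewrite <- norm_scal_pos by lra.
  replace (scal 2 (F i z)) with (minus (F i (plus y z)) (F i (plus y (opp z)))).
  { apply norm_minus_le. }
  rewrite 2!(lin_plus _ (F_linear i)), (lin_opp _ (F_linear i)).
  module_eq. }
lra.
Qed.

Lemma unbounded_ball (n : nat) (y : V) (r : R) :
  0 < r -> exists y' r', 0 < r' <= r / 2 /\ norm (minus y' y) <= r / 2 /\
    exists i, forall x, norm (minus x y') <= r' -> INR n < norm (F i x).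
Proof using F_linear F_unbounded.
intros Hr.
assert (HK := pos_INR n).
(* The extra 1 absorbs the variation of [F i], whose bound is [B], over a ball of radius at most
   [/ B]. *)
destruct (unbounded_near y (r / 2) (INR n + 1)) as [i [z [Hz HF]]]; [lra|lra|].
destruct (linear_norm _ (F_linear i)) as [B [HB HFB]].
assert (HB' : 0 < / B) by now apply Rinv_0_lt_compat.
exists (plus y z), (Rmin (r / 2) (/ B)).
split; [split; [apply Rmin_pos; lra|apply Rmin_l]|].
split.
{ replace (minus (plus y z) y) with z by module_eq. easy. }
exists i. intros x Hx.
assert (H1 : norm (F i (minus (plus y z) x)) <= 1).
{ eapply Rle_trans; [apply HFB|]. rewrite norm_minus_sym.
  replace 1 with (B * / B) by (field; lra).
  apply Rmult_le_compat_l; [lra|]. generalize (Rmin_r (r / 2) (/ B)); lra. }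
assert (H2 : norm (F i (plus y z)) <= norm (F i x) + norm (F i (minus (plus y z) x))).
{ rewrite (lin_minus _ (F_linear i)).
  set (a := F i (plus y z)). set (b := F i x).
  replace a with (plus b (minus a b)) at 1 by module_eq. apply norm_plus_le. }
lra.
Qed.

(** Nested closed balls, on the n-th of which some [F i] exceeds [n] in norm, shrink to a point
    where the whole family is unbounded. *)
Lemma unbounded_at_point : exists x, forall C, exists i, C < norm (F i x).
Proof using F_linear F_unbounded.
(* The premise [0 < snd p] stands inside the existential so that choice yields a total step
   function, which can be iterated without carrying positivity proofs. *)
assert (Hstep : forall n (p : V * R), exists q : V * R, 0 < snd p ->
  0 < snd q <= snd p / 2 /\ norm (minus (fst q) (fst p)) <= snd p / 2 /\
    exists i, forall x, norm (minus x (fst q)) <= snd q -> INR n < norm (F i x)).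
{ intros n [y r]. destruct (classic (0 < r)) as [Hr|Hr].
  - destruct (unbounded_ball n y r Hr) as [y' [r' H]]. now exists (y', r').
  - exists (y, r). now intros H. }
set (g := fun n p => proj1_sig (constructive_indefinite_description _ (Hstep n p))).
assert (Hg : forall n p, 0 < snd p ->
  0 < snd (g n p) <= snd p / 2 /\ norm (minus (fst (g n p)) (fst p)) <= snd p / 2 /\
    exists i, forall x, norm (minus x (fst (g n p))) <= snd (g n p) ->
      INR n < norm (F i x)).
{ intros n p. exact (proj2_sig (constructive_indefinite_description _ (Hstep n p))). }
clearbody g. clear Hstep.
set (p := fix p n := match n with O => (zero : V, 1) | Datatypes.S n => g n (p n) end).
assert (Hp : forall n, 0 < snd (p n)).
{ induction n as [|n IH]; [simpl; lra|]. apply (Hg n (p n) IH). }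
assert (Hp2 : forall n, snd (p n) <= (1 / 2) ^ n).
{ induction n as [|n IH]; [simpl; lra|].
  generalize (Hg n (p n) (Hp n)). change (g n (p n)) with (p (Datatypes.S n)).
  simpl pow. lra. }
destruct (cauchy_limit (fun n => fst (p n)) (fun n => snd (p n))) as [x Hx].
- intros n m Hnm.
  (* Each centre moves by at most half the radius and the radius loses at least half, so the
     distances telescope against the loss of radius. *)
  assert (H : norm (minus (fst (p m)) (fst (p n))) <= snd (p n) - snd (p m)).
  { induction Hnm as [|m Hnm IH]; [rewrite norm_minus_self; lra|].
    destruct (Hg m (p m) (Hp m)) as [H1 [H2 _]].
    change (g m (p m)) with (p (Datatypes.S m)) in H1, H2.
    eapply Rle_trans; [apply (norm_minus_triangle (fst (p m)))|]. lra. }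
  generalize (Hp m); lra.
- intros eps Heps.
  destruct (pow_lt_1_zero (1 / 2) ltac:(rewrite Rabs_right; lra) eps Heps) as [N HN].
  exists N. eapply Rle_lt_trans; [apply Hp2|].
  eapply Rle_lt_trans; [apply Rle_abs|]. apply HN; lia.
- exists x. intros C.
  destruct (INR_unbounded C) as [n Hn].
  destruct (Hg n (p n) (Hp n)) as [_ [_ [i Hi]]].
  exists i. eapply Rlt_trans; [exact Hn|]. apply Hi.
  apply (Hx (Datatypes.S n)).
Qed.

End UniformBoundedness.

Lemma uniform_boundedness (I : Type) (F : I -> V -> V) :
  (forall i, is_linear (F i)) -> (forall x, exists C, forall i, norm (F i x) <= C) ->
  exists M, 0 < M /\ forall i x, norm (F i x) <= M * norm x.
Proof.
intros HF Hb. apply NNPP. intros Hn.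
destruct (unbounded_at_point I F HF) as [x Hx].
{ intros M HM. apply NNPP. intros H. apply Hn. exists M. split; [easy|].
  intros i x. apply Rnot_lt_le. intros H'. apply H. now exists i, x. }
destruct (Hb x) as [C HC]. destruct (Hx C) as [i Hi].
generalize (HC i); lra.
Qed.

End Completeness.

(** * Convolution with a semigroup *)

Section Semigroup.

Context {V : CompleteNormedModule R_AbsRing}.
Implicit Types (f g u : R -> V) (x y z : V).

Lemma uniformly_continuous f a b (eps : R) :
  (forall t, continuous f t) -> 0 < eps ->
  exists delta, 0 < delta /\ forall s t, a <= s <= b -> a <= t <= b ->
    Rabs (t - s) < delta -> norm (minus (f t) (f s)) < eps.
Proof.
intros Hf Heps.
destruct (unifcont_normed_1d f a b (fun t _ => Hf t) (mkposreal eps Heps)) as [d Hd].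
exists d. split; [apply cond_pos|]. intros s t Hs Ht Hst. exact (Hd s t Hs Ht Hst).
Qed.

Lemma continuous_bounded f a b :
  (forall t, continuous f t) ->
  exists K, 0 < K /\ forall t, a <= t <= b -> norm (f t) <= K.
Proof.
intros Hf. destruct (bounded_continuity f a b (fun t _ => Hf t)) as [M HM].
exists (Rmax 1 M). split; [generalize (Rmax_l 1 M); lra|].
intros t Ht. generalize (HM t Ht) (Rmax_r 1 M). lra.
Qed.

(* Extending the semigroup by the identity to negative times removes all
   one-sided limits. *)
Record extended_semigroup (T : R -> V -> V) : Prop := {
  es_linear : forall t, is_linear (T t);
  es_zero : forall x, T 0 x = x;
  es_plus : forall s t x, 0 <= s -> 0 <= t -> T (s + t) x = T s (T t x);
  es_continuous : forall x t, continuous (fun s : R => T s x) t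
}.

Variable T : R -> V -> V.
Hypothesis hT : extended_semigroup T.

Let T_linear := es_linear T hT.
Let T_zero := es_zero T hT.
Let T_plus := es_plus T hT.
Let T_continuous := es_continuous T hT.

(** Each orbit is bounded on [[a, b]] by continuity; uniform boundedness over the times in [[a, b]]
    makes the bound proportional to [norm x]. *)
Lemma semigroup_bound a b :
  exists M, 0 < M /\ forall t x, a <= t <= b -> norm (T t x) <= M * norm x.
Proof using hT.
destruct (uniform_boundedness {t | a <= t <= b} (fun i => T (proj1_sig i)))
  as [M [HM H]].
- intros i. apply T_linear.
- intros x. destruct (continuous_bounded (fun t => T t x) a b (T_continuous x))
    as [K [_ HK]].
  exists K. intros [t Ht]. now apply HK.
- exists M. split; [easy|]. intros t x Ht. apply (H (exist _ t Ht)).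
Qed.

(** Moving [f p] to [f q] costs the local bound of the semigroup; moving [s] to [r] then involves a
    single orbit. *)
Lemma semigroup_jointly_continuous f r q (eps : R) :
  continuous f q -> 0 < eps ->
  exists delta, 0 < delta /\ forall s p, Rabs (s - r) < delta -> Rabs (p - q) < delta ->
    norm (minus (T s (f p)) (T r (f q))) < eps.
Proof using hT.
intros Hf Heps.
destruct (semigroup_bound (r - 1) (r + 1)) as [M [HM HTM]].
assert (HeM : 0 < eps / (2 * M)) by (apply Rdiv_lt_0_compat; lra).
destruct (proj1 (continuous_eps _ _) Hf _ HeM) as [d1 [Hd1 H1]].
destruct (proj1 (continuous_eps _ _) (T_continuous (f q) r) (eps / 2) ltac:(lra))
  as [d2 [Hd2 H2]].
exists (Rmin 1 (Rmin d1 d2)). split; [repeat apply Rmin_pos; lra|].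
intros s p Hs Hp.
assert (Hd : Rmin 1 (Rmin d1 d2) <= 1 /\ Rmin 1 (Rmin d1 d2) <= d1 /\
  Rmin 1 (Rmin d1 d2) <= d2).
{ generalize (Rmin_l 1 (Rmin d1 d2)) (Rmin_r 1 (Rmin d1 d2)) (Rmin_l d1 d2)
    (Rmin_r d1 d2); lra. }
apply Rle_lt_trans with
  (norm (minus (T s (f p)) (T s (f q))) + norm (minus (T s (f q)) (T r (f q))));
  [apply norm_minus_triangle|].
rewrite <- (lin_minus _ (T_linear s)).
assert (Hb : norm (T s (minus (f p) (f q))) <= eps / 2).
{ eapply Rle_trans; [apply HTM|].
  - destruct (Rabs_def2 (s - r) 1); lra.
  - replace (eps / 2) with (M * (eps / (2 * M))) by (field; lra).
    apply Rmult_le_compat_l; [lra|]. left. apply H1. lra. }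
generalize (H2 s ltac:(lra)). lra.
Qed.

Lemma continuous_conv_integrand f r :
  (forall q, continuous f q) -> forall q, continuous (fun q : R => T (r - q) (f q)) q.
Proof using hT.
intros Hf q. apply continuous_eps. intros eps Heps.
destruct (semigroup_jointly_continuous f (r - q) q eps (Hf q) Heps) as [d [Hd H]].
exists d. split; [easy|]. intros s Hs. apply H; [|easy].
replace (r - s - (r - q)) with (- (s - q)) by ring. now rewrite Rabs_Ropp.
Qed.

(** The Duhamel integral: the mild solution of [v' = A0 v + f] with [v 0 = 0]. *)
Definition conv f (r : R) : V := RInt (fun q => T (r - q) (f q)) 0 r.

Lemma conv_zero f : conv f 0 = zero.
Proof. unfold conv. exact (RInt_point 0 _). Qed.

(** Cutting at [h] and shifting the variable puts the increment on [f], where differentiability of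
    [f] can be used. *)
Lemma conv_shift f a h :
  (forall q, continuous f q) ->
  conv f (a + h) =
  plus (RInt (fun q => T (a + h - q) (f q)) 0 h)
       (RInt (fun q => T (a - q) (f (q + h))) 0 a).
Proof using hT.
intros Hf. unfold conv.
assert (Hc := continuous_conv_integrand f (a + h) Hf).
rewrite <- (RInt_cont_Chasles _ 0 h (a + h) Hc). f_equal.
transitivity (RInt (fun q => T (a + h - q) (f q)) (0 + h) (a + h)).
{ f_equal. ring. }
rewrite <- (RInt_shift _ h 0 a Hc).
apply RInt_ext. intros q _. f_equal. ring.
Qed.

(** Cutting at [a] instead puts the increment on the semigroup, which exposes [T h] acting on
    [conv f a] and hence the generator. *)
Lemma conv_semigroup f a h :
  (forall q, continuous f q) -> 0 <= a -> 0 <= h ->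
  conv f (a + h) =
  plus (T h (conv f a)) (RInt (fun q => T (a + h - q) (f q)) a (a + h)).
Proof using hT.
intros Hf Ha Hh. unfold conv.
rewrite <- (RInt_cont_Chasles _ 0 a (a + h) (continuous_conv_integrand f (a + h) Hf)).
f_equal. rewrite <- RInt_linear;
  [|easy|apply ex_RInt_cont; now apply continuous_conv_integrand].
apply RInt_ext. intros q Hq. rewrite Rmin_left, Rmax_right in Hq by easy.
rewrite <- T_plus by lra. f_equal. ring.
Qed.

Lemma conv_increment f a h :
  (forall q, continuous f q) ->
  minus (conv f (a + h)) (conv f a) =
  plus (RInt (fun q => T (a + h - q) (f q)) 0 h)
       (RInt (fun q => T (a - q) (minus (f (q + h)) (f q))) 0 a).
Proof using hT.
intros Hf. rewrite (conv_shift f a h Hf). unfold conv.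
assert (Hf' : forall q, continuous (fun q : R => f (q + h)) q)
  by (intros q; now apply continuous_shift).
set (I1 := RInt (fun q => T (a + h - q) (f q)) 0 h).
rewrite (RInt_ext (fun q => T (a - q) (minus (f (q + h)) (f q)))
  (fun q => minus (T (a - q) (f (q + h))) (T (a - q) (f q)))).
2:{ intros q _. apply lin_minus, T_linear. }
rewrite (RInt_cont_minus (fun q => T (a - q) (f (q + h))) (fun q => T (a - q) (f q)));
  [|now apply (continuous_conv_integrand (fun q => f (q + h)))
   |now apply continuous_conv_integrand].
module_eq.
Qed.

Lemma continuous_minus_fun f g :
  (forall t, continuous f t) -> (forall t, continuous g t) ->
  forall t, continuous (fun t : R => minus (f t) (g t)) t.
Proof. intros Hf Hg t. now apply (continuous_minus f g). Qed.

Lemma conv_continuous f :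
  (forall q, continuous f q) -> continuous_on (fun r => 0 <= r) (conv f).
Proof using hT.
intros Hf. apply continuous_on_eps. intros r Hr eps Heps.
destruct (semigroup_bound 0 (r + 1)) as [M [HM HTM]].
destruct (continuous_bounded f 0 (r + 1) Hf) as [K [HK HfK]].
set (eta := eps / (4 * M * (r + 1))).
assert (Heta : 0 < eta) by (apply Rdiv_lt_0_compat; [lra|repeat apply Rmult_lt_0_compat; lra]).
destruct (uniformly_continuous f 0 (r + 1) eta Hf Heta) as [d [Hd Hfd]].
set (d' := eps / (4 * M * K)).
assert (Hd' : 0 < d') by (apply Rdiv_lt_0_compat; [lra|repeat apply Rmult_lt_0_compat; lra]).
(* Uniform in the base point [a]: an approach from the left is a forward increment starting at
   [s < r]. *)
assert (H : forall a h, 0 <= a -> 0 <= h -> a + h <= r + 1 -> h < d -> h < d' ->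
  norm (minus (conv f (a + h)) (conv f a)) < eps).
{ intros a h Ha Hh Hah Hhd Hhd'.
  rewrite (conv_increment f a h Hf).
  apply Rle_lt_trans with (h * (M * K) + a * (M * eta)).
  - eapply Rle_trans; [apply norm_plus_le|]. apply Rplus_le_compat.
    + replace (h * (M * K)) with ((h - 0) * (M * K)) by ring.
      apply norm_RInt_cont_le; [now apply continuous_conv_integrand|easy|].
      intros q Hq. eapply Rle_trans; [apply HTM; lra|].
      apply Rmult_le_compat_l; [lra|]. apply HfK; lra.
    + replace (a * (M * eta)) with ((a - 0) * (M * eta)) by ring.
      apply norm_RInt_cont_le; [|easy|].
      * apply (continuous_conv_integrand (fun q => minus (f (q + h)) (f q))).
        apply continuous_minus_fun; [|easy]. intros q; now apply continuous_shift.
      * intros q Hq. eapply Rle_trans; [apply HTM; lra|].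
        apply Rmult_le_compat_l; [lra|]. left. apply Hfd; [lra|lra|].
        apply Rabs_def1; lra.
  - assert (H1 : h * (M * K) <= eps / 4).
    { replace (eps / 4) with (d' * (M * K)) by (unfold d'; field; lra).
      apply Rmult_le_compat_r; [|lra]. left; now apply Rmult_lt_0_compat. }
    assert (H2 : a * (M * eta) <= eps / 4).
    { replace (eps / 4) with ((r + 1) * (M * eta)) by (unfold eta; field; lra).
      apply Rmult_le_compat_r; [|lra]. left; now apply Rmult_lt_0_compat. }
    lra. }
exists (Rmin 1 (Rmin d d')). split; [repeat apply Rmin_pos; lra|].
intros s Hs Hsr.
assert (Hmin : Rmin 1 (Rmin d d') <= 1 /\ Rmin 1 (Rmin d d') <= d /\
  Rmin 1 (Rmin d d') <= d').
{ generalize (Rmin_l 1 (Rmin d d')) (Rmin_r 1 (Rmin d d')) (Rmin_l d d')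
    (Rmin_r d d'); lra. }
apply Rabs_def2 in Hsr.
destruct (Rle_lt_dec r s) as [Hle|Hlt].
- replace s with (r + (s - r)) by ring. apply H; lra.
- rewrite norm_minus_sym. replace r with (s + (r - s)) at 1 by ring. apply H; lra.
Qed.

(** The increment is the integral of [f'], which is uniformly continuous on a compact interval; the
    uniformity in [q] allows differentiation under the integral. *)
Lemma uniform_right_deriv f f' b (eps : R) :
  (forall t, continuous f t) -> (forall t, continuous f' t) ->
  (forall t, 0 <= t -> right_deriv f t (f' t)) -> 0 < eps ->
  exists delta, 0 < delta /\ forall q h, 0 <= q <= b -> 0 < h < delta ->
    norm (minus (minus (f (q + h)) (f q)) (scal h (f' q))) <= h * eps.
Proof.
intros Hf Hf' Hd Heps.
destruct (uniformly_continuous f' 0 (b + 1) eps Hf' Heps) as [d [Hd0 Hfd]].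
exists (Rmin 1 d). split; [apply Rmin_pos; lra|]. intros q h Hq Hh.
assert (Hmin : Rmin 1 d <= 1 /\ Rmin 1 d <= d)
  by (generalize (Rmin_l 1 d) (Rmin_r 1 d); lra).
rewrite (minus_eq_RInt f f' q (q + h)); [|lra|easy|easy|].
- replace h with (q + h - q) at 2 3 by ring.
  apply norm_RInt_minus_const_le; [easy|lra|].
  intros t Ht. left. apply Hfd; [lra|lra|apply Rabs_def1; lra].
- intros t Ht. apply Hd; lra.
Qed.

(** The piece over [[0, h]] contributes [T r (f 0)]; under the remaining integral the difference
    quotients of [f] converge uniformly to [f']. *)
Lemma conv_right_deriv f f' r :
  (forall t, continuous f t) -> (forall t, continuous f' t) ->
  (forall t, 0 <= t -> right_deriv f t (f' t)) -> 0 <= r ->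
  right_deriv (conv f) r (plus (T r (f 0)) (conv f' r)).
Proof using hT.
intros Hf Hf' Hd Hr eps Heps.
destruct (semigroup_bound 0 r) as [M [HM HTM]].
set (eta := eps / (2 * M * (r + 1))).
assert (Heta : 0 < eta) by (apply Rdiv_lt_0_compat; [lra|repeat apply Rmult_lt_0_compat; lra]).
destruct (uniform_right_deriv f f' r eta Hf Hf' Hd Heta) as [d1 [Hd1 H1]].
destruct (semigroup_jointly_continuous f r 0 (eps / 2) (Hf 0) ltac:(lra))
  as [d2 [Hd2 H2]].
exists (Rmin d1 d2). split; [apply Rmin_pos; lra|]. intros h Hh.
assert (Hmin : Rmin d1 d2 <= d1 /\ Rmin d1 d2 <= d2)
  by (generalize (Rmin_l d1 d2) (Rmin_r d1 d2); lra).
rewrite (conv_increment f r h Hf).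
assert (Hfh : forall q, continuous (fun q : R => minus (f (q + h)) (f q)) q).
{ apply continuous_minus_fun; [|easy]. intros q; now apply continuous_shift. }
assert (Hsf : forall q, continuous (fun q : R => scal h (f' q)) q).
{ intros q. apply (continuous_scal_r h f'). easy. }
assert (Hrem : minus (RInt (fun q => T (r - q) (minus (f (q + h)) (f q))) 0 r)
    (scal h (conv f' r)) =
  RInt (fun q => T (r - q) (minus (minus (f (q + h)) (f q)) (scal h (f' q)))) 0 r).
{ unfold conv. rewrite <- RInt_cont_scal by now apply continuous_conv_integrand.
  rewrite <- RInt_cont_minus;
    [|now apply (continuous_conv_integrand (fun q => minus (f (q + h)) (f q)))|].
  - apply RInt_ext. intros q _.
    now rewrite <- (lin_scal _ (T_linear _)), <- (lin_minus _ (T_linear _)).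
  - intros q. apply (continuous_scal_r h (fun q => T (r - q) (f' q))).
    now apply continuous_conv_integrand. }
set (I1 := RInt (fun q => T (r + h - q) (f q)) 0 h).
set (I2 := RInt (fun q => T (r - q) (minus (f (q + h)) (f q))) 0 r) in *.
apply Rle_trans with (norm (plus (minus I1 (scal (h - 0) (T r (f 0))))
  (minus I2 (scal h (conv f' r))))).
{ right. f_equal. module_eq. }
rewrite Hrem.
apply Rle_trans with ((h - 0) * (eps / 2) + (r - 0) * (M * (h * eta))).
- eapply Rle_trans; [apply norm_plus_le|]. apply Rplus_le_compat.
  + apply norm_RInt_minus_const_le; [now apply continuous_conv_integrand|lra|].
    intros q Hq. left. apply H2; apply Rabs_def1; lra.
  + apply norm_RInt_cont_le; [|lra|].
    * apply (continuous_conv_integrand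
        (fun q => minus (minus (f (q + h)) (f q)) (scal h (f' q)))).
      now apply continuous_minus_fun.
    * intros q Hq. eapply Rle_trans; [apply HTM; lra|].
      apply Rmult_le_compat_l; [lra|]. apply H1; lra.
- assert (H : (r - 0) * (M * (h * eta)) <= (r + 1) * (M * (h * eta))).
  { apply Rmult_le_compat_r; [|lra]. apply Rmult_le_pos; [lra|].
    apply Rmult_le_pos; lra. }
  replace ((r + 1) * (M * (h * eta))) with (h * (eps / 2)) in H
    by (unfold eta; field; lra).
  lra.
Qed.

(** The graph of the generator. As a relation it carries membership in the domain and the value
    together. *)
Definition generates x y : Prop := right_deriv (fun t => T t x) 0 y.

Lemma generates_unique x y z : generates x y -> generates x z -> y = z.
Proof. apply right_deriv_unique. Qed.

Lemma generates_plus x x' y y' :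
  generates x y -> generates x' y' -> generates (plus x x') (plus y y').
Proof using hT.
intros H H'. apply right_deriv_ext with (3 := right_deriv_plus _ _ _ _ _ H H') (d := 1);
  [lra|].
intros s _. symmetry. apply lin_plus, T_linear.
Qed.

Lemma generates_comm (L : V -> V) x y :
  is_linear L -> (forall t z, 0 <= t -> L (T t z) = T t (L z)) ->
  generates x y -> generates (L x) (L y).
Proof.
intros HL HLT H.
apply right_deriv_ext with (3 := right_deriv_linear L _ _ _ HL H) (d := 1); [lra|].
intros s Hs. apply HLT. lra.
Qed.

Lemma is_linear_scal (r : R) : is_linear (fun x : V => scal r x).
Proof. apply (@is_linear_scal_r _ V). intros n m. apply Rmult_comm. Qed.

Lemma generates_scal (r : R) x y : generates x y -> generates (scal r x) (scal r y).
Proof using hT.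
apply (generates_comm (fun x => scal r x) x y); [apply is_linear_scal|].
intros t z _. symmetry. apply lin_scal, T_linear.
Qed.

Lemma generates_minus x x' y y' :
  generates x y -> generates x' y' -> generates (minus x x') (minus y y').
Proof using hT.
intros H H'. apply right_deriv_ext with (3 := right_deriv_minus _ _ _ _ _ H H') (d := 1);
  [lra|].
intros s _. symmetry. apply lin_minus, T_linear.
Qed.

Lemma generates_zero : generates zero zero.
Proof using hT.
apply right_deriv_ext with (3 := right_deriv_const zero 0) (d := 1); [lra|].
intros s _. symmetry. apply lin_zero, T_linear.
Qed.

Lemma generates_orbit x y t : 0 <= t -> generates x y -> generates (T t x) (T t y).
Proof using hT.
intros Ht. apply generates_comm; [apply T_linear|].
intros s z Hs. rewrite <- 2!T_plus by easy. f_equal. ring.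
Qed.

Lemma orbit_right_deriv x y t :
  0 <= t -> generates (T t x) y -> right_deriv (fun s => T s x) t y.
Proof using hT.
intros Ht H eps Heps. destruct (H eps Heps) as [d [Hd H1]].
exists d. split; [easy|]. intros h Hh. specialize (H1 h Hh).
rewrite T_zero in H1. rewrite Rplus_0_l, <- T_plus in H1 by lra.
now rewrite (Rplus_comm t h).
Qed.

(** [T h] moves [conv f r] by the increment of [conv f] minus the integral over [[r, r + h]], and
    the latter is [h * f r] to first order. *)
Lemma conv_generates f y r :
  (forall t, continuous f t) -> 0 <= r -> right_deriv (conv f) r y ->
  generates (conv f r) (minus y (f r)).
Proof using hT.
intros Hf Hr H eps Heps.
destruct (H (eps / 2) ltac:(lra)) as [d1 [Hd1 H1]].
destruct (semigroup_jointly_continuous f 0 r (eps / 2) (Hf r) ltac:(lra))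
  as [d2 [Hd2 H2]].
exists (Rmin d1 d2). split; [apply Rmin_pos; lra|]. intros h Hh.
assert (Hmin : Rmin d1 d2 <= d1 /\ Rmin d1 d2 <= d2)
  by (generalize (Rmin_l d1 d2) (Rmin_r d1 d2); lra).
rewrite T_zero, Rplus_0_l.
specialize (H1 h ltac:(lra)). rewrite (conv_semigroup f r h Hf) in H1 by lra.
set (I := RInt (fun q => T (r + h - q) (f q)) r (r + h)) in *.
assert (HI : norm (minus I (scal (r + h - r) (f r))) <= (r + h - r) * (eps / 2)).
{ apply norm_RInt_minus_const_le; [now apply continuous_conv_integrand|lra|].
  intros q Hq. rewrite <- (T_zero (f r)) at 1. left.
  apply H2; apply Rabs_def1; lra. }
set (c := conv f r) in *.
apply Rle_trans with (norm (minus
  (minus (minus (plus (T h c) I) c) (scal h y)) (minus I (scal (r + h - r) (f r))))).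
{ right. f_equal. module_eq. }
eapply Rle_trans; [apply norm_minus_le|]. lra.
Qed.

(** The averages of the orbit over [[0, h]] lie in the domain. They are [conv] of the constant [x]
    scaled by [/ h], and that convolution has right derivative [x] at 0. *)
Lemma generator_dense x (eps : R) :
  0 < eps -> exists z y, generates z y /\ norm (minus z x) <= eps.
Proof using hT.
intros Heps.
assert (Hc : forall z t, continuous (fun _ : R => z : V) t)
  by (intros z t; apply continuous_const).
assert (Hd : forall r, 0 <= r -> right_deriv (conv (fun _ => x)) r
  (plus (T r x) (conv (fun _ => zero) r))).
{ intros r Hr. apply (conv_right_deriv (fun _ => x) (fun _ => zero)); auto.
  intros t _. apply right_deriv_const. }
destruct (Hd 0 (Rle_refl 0) eps Heps) as [d [Hd0 H]].
set (h := d / 2). assert (Hh : 0 < h < d) by (unfold h; lra).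
exists (scal (/ h) (conv (fun _ => x) h)).
eexists. split.
- apply generates_scal.
  apply (conv_generates (fun _ => x)); [auto|lra|apply Hd; lra].
- specialize (H h Hh). rewrite Rplus_0_l, 2!conv_zero, T_zero in H.
  apply Rmult_le_reg_l with h; [lra|]. rewrite <- norm_scal_pos by lra.
  rewrite (Rmult_comm h). eapply Rle_trans; [|exact H].
  right. f_equal. module_eq.
Qed.

(* [s |-> T (b - s) (u s)] has right derivative zero. *)
Lemma homogeneous_unique u b :
  (forall t, continuous u t) -> 0 <= b -> u 0 = zero ->
  (forall t, 0 <= t < b -> exists y, generates (u t) y /\ right_deriv u t y) ->
  u b = zero.
Proof using hT.
intros Hu Hb H0 H.
assert (Heq : T (b - b) (u b) = T (b - 0) (u 0)).
{ apply (right_deriv_zero_const (fun s => T (b - s) (u s)) 0 b Hb).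
  - intros t _. now apply continuous_conv_integrand.
  - intros t Ht eps Heps. destruct (H t Ht) as [y [Hg Hd]].
    destruct (semigroup_bound 0 b) as [M [HM HTM]].
    assert (HeM : 0 < eps / (2 * M)) by (apply Rdiv_lt_0_compat; lra).
    destruct (Hg _ HeM) as [d1 [Hd1 H1]]. destruct (Hd _ HeM) as [d2 [Hd2 H2]].
    exists (Rmin (b - t) (Rmin d1 d2)). split; [repeat apply Rmin_pos; lra|].
    intros h Hh.
    assert (Hmin : Rmin (b - t) (Rmin d1 d2) <= b - t /\
      Rmin (b - t) (Rmin d1 d2) <= d1 /\ Rmin (b - t) (Rmin d1 d2) <= d2).
    { generalize (Rmin_l (b - t) (Rmin d1 d2)) (Rmin_r (b - t) (Rmin d1 d2))
        (Rmin_l d1 d2) (Rmin_r d1 d2); lra. }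
    specialize (H1 h ltac:(lra)). specialize (H2 h ltac:(lra)).
    rewrite T_zero, Rplus_0_l in H1.
    (* Both values are brought under the same operator [T (b - (t + h))]; [u (t + h)] and
       [T h (u t)] agree to first order because both have right derivative [y]. *)
    replace (T (b - t) (u t)) with (T (b - (t + h)) (T h (u t))).
    2:{ rewrite <- T_plus by lra. f_equal. ring. }
    rewrite <- (lin_minus _ (T_linear _)).
    apply Rle_trans with (norm (T (b - (t + h)) (minus (u (t + h)) (T h (u t))))).
    { right. f_equal. module_eq. }
    eapply Rle_trans; [apply HTM; lra|].
    replace (eps * h) with (M * (eps / (2 * M) * h + eps / (2 * M) * h))
      by (field; lra).
    apply Rmult_le_compat_l; [lra|].
    apply Rle_trans with (norm (minus
      (minus (minus (u (t + h)) (u t)) (scal h y))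
      (minus (minus (T h (u t)) (u t)) (scal h y)))).
    { right. f_equal. module_eq. }
    eapply Rle_trans; [apply norm_minus_le|]. lra. }
rewrite Rminus_diag, T_zero, H0, (lin_zero _ (T_linear _)) in Heq. exact Heq.
Qed.

End Semigroup.

(** * The delay equation over the reals *)

Section DysonPhillips.

Context {V : CompleteNormedModule R_AbsRing}.
Implicit Types (f g u w : R -> V) (x y z : V).

Variable T : R -> V -> V.
Hypothesis hT : extended_semigroup T.
Variable A : V -> V.
Hypothesis hA : is_linear A.

Lemma continuous_linear_fun (L : V -> V) u :
  is_linear L -> (forall t, continuous u t) -> forall t, continuous (fun s : R => L (u s)) t.
Proof.
intros HL Hu t. apply (continuous_comp u L); [easy|]. exact (linear_cont L (u t) HL).
Qed.

(* With [r = t - n tau] this is the paper's [S_n(t, n tau)], which depends on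
   [tau] only through that shift. *)
Fixpoint dyson (n : nat) (r : R) (x : V) : V :=
  match n with
  | O => T r x
  | Datatypes.S m => conv T (fun q => A (dyson m q x)) (Rmax 0 r)
  end.

Lemma dyson_continuous n x t : continuous (fun r : R => dyson n r x) t.
Proof using hT hA.
revert t; induction n as [|n IH]; intros t; [now apply (es_continuous T hT)|].
apply (continuous_on_clamp 0 (conv T (fun q => A (dyson n q x)))).
apply conv_continuous; [easy|].
now apply (continuous_linear_fun A (fun q => dyson n q x)).
Qed.

Lemma source_continuous n x t : continuous (fun r : R => A (dyson n r x)) t.
Proof using hT hA.
apply (continuous_linear_fun A (fun q => dyson n q x)); [easy|].
apply dyson_continuous.
Qed.

(** The clamp in [dyson] thus plays the part of the indicator of [t >= n tau] for positive
    indices. *)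
Lemma dyson_nonpos n r x : r <= 0 -> dyson (Datatypes.S n) r x = zero.
Proof. intros Hr. simpl. rewrite Rmax_left by easy. apply conv_zero. Qed.

(** Stated for any commuting [L] so that multiplication by a complex number, at this level just a
    real-linear map, can be taken for it. *)
Lemma dyson_comm (L : V -> V) n r x :
  is_linear L -> (forall t z, L (T t z) = T t (L z)) ->
  (forall z, L (A z) = A (L z)) -> L (dyson n r x) = dyson n r (L x).
Proof using hT hA.
intros HL HLT HLA. revert r. induction n as [|n IH]; intros r; [apply HLT|].
simpl. unfold conv. rewrite <- RInt_linear;
  [|easy|apply ex_RInt_cont, continuous_conv_integrand; [easy|apply source_continuous]].
apply RInt_ext. intros q _. now rewrite HLT, HLA, IH.
Qed.

Lemma dyson_plus n r x y : dyson n r (plus x y) = plus (dyson n r x) (dyson n r y).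
Proof using hT hA.
revert r. induction n as [|n IH]; intros r; [apply lin_plus, (es_linear T hT)|].
simpl. unfold conv. rewrite <- RInt_cont_plus.
- apply RInt_ext. intros q _.
  now rewrite IH, (lin_plus A hA), (lin_plus _ (es_linear T hT _)).
- apply continuous_conv_integrand; [easy|apply source_continuous].
- apply continuous_conv_integrand; [easy|apply source_continuous].
Qed.

Lemma dyson_bound n b :
  exists M, 0 < M /\ forall r x, - b <= r <= b -> norm (dyson n r x) <= M * norm x.
Proof using hT hA.
destruct (Rlt_le_dec b 0) as [Hb|Hb]; [exists 1; split; [lra|intros; lra]|].
destruct (semigroup_bound T hT (- b) b) as [M [HM HTM]].
destruct (linear_norm A hA) as [B [HB HAB]].
induction n as [|n [K [HK IH]]]; [now exists M|].
(* The factors bound the length of the interval, the semigroup, [A] and the previous term; [b + 1]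
   is positive even at [b = 0]. *)
exists ((b + 1) * (M * (B * K))). split; [repeat apply Rmult_lt_0_compat; lra|].
intros r x Hr.
assert (Hpos : 0 <= M * (B * (K * norm x))).
{ assert (H := norm_ge_0 x). repeat (apply Rmult_le_pos; [lra|]). easy. }
replace ((b + 1) * (M * (B * K)) * norm x)
  with ((b + 1) * (M * (B * (K * norm x)))) by ring.
destruct (Rle_lt_dec r 0) as [Hr0|Hr0].
{ rewrite norm_of_zero by now apply dyson_nonpos. apply Rmult_le_pos; lra. }
simpl. rewrite Rmax_right by lra. unfold conv.
apply Rle_trans with ((r - 0) * (M * (B * (K * norm x)))).
- apply norm_RInt_cont_le; [|lra|].
  + apply continuous_conv_integrand; [easy|apply source_continuous].
  + intros q Hq. eapply Rle_trans; [apply HTM; lra|].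
    apply Rmult_le_compat_l; [lra|]. eapply Rle_trans; [apply HAB|].
    apply Rmult_le_compat_l; [lra|]. apply IH; lra.
- apply Rmult_le_compat_r; lra.
Qed.

(** The graph relation encodes U_n' = A0 U_n + A U_(n-1). Continuity of [d] is part of the
    induction: [A (d q)] is the derivative of the next source. *)
Lemma dyson_C1 n x y :
  generates T x y ->
  exists d : R -> V, (forall t, continuous d t) /\ forall t, 0 <= t ->
    right_deriv (fun r => dyson n r x) t (d t) /\
    generates T (dyson n t x)
      (minus (d t) (match n with O => zero | Datatypes.S m => A (dyson m t x) end)).
Proof using hT hA.
intros Hxy. induction n as [|n [d [Hd IH]]].
- exists (fun t => T t y). split; [intros t; now apply (es_continuous T hT)|].
  intros t Ht.
  assert (H : generates T (T t x) (T t y)) by now apply generates_orbit.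
  split; [now apply orbit_right_deriv|].
  replace (minus (T t y) zero) with (T t y) by module_eq. exact H.
- set (f := fun q => A (dyson n q x)). set (f' := fun q => A (d q)).
  assert (Hf : forall t, continuous f t) by (intros t; apply source_continuous).
  assert (Hf' : forall t, continuous f' t) by now apply continuous_linear_fun.
  exists (fun t => plus (T t (f 0)) (conv T f' (Rmax 0 t))). split.
  { intros t. apply (continuous_plus (fun t : R => T t (f 0))
      (fun t : R => conv T f' (Rmax 0 t))); [now apply (es_continuous T hT)|].
    apply (continuous_on_clamp 0 (conv T f')). now apply conv_continuous. }
  intros t Ht. rewrite Rmax_right by easy.
  assert (Hrd : right_deriv (conv T f) t (plus (T t (f 0)) (conv T f' t))).
  { apply conv_right_deriv; try easy. intros s Hs.
    apply (right_deriv_linear A (fun q => dyson n q x)); [easy|]. now apply IH. }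
  split.
  + apply right_deriv_ext with (3 := Hrd) (d := 1); [lra|].
    intros s Hs. simpl. rewrite Rmax_right by lra. reflexivity.
  + simpl. rewrite Rmax_right by easy. now apply (conv_generates T hT f).
Qed.

(** * Summation over the delays *)

Section Delay.

Variable tau : R.
Hypothesis htau : 0 < tau.

Definition delay_sum (N : nat) (t : R) (x : V) : V :=
  sum_n (fun n => dyson n (t - INR n * tau) x) N.

Lemma delay_sum_S N t x :
  delay_sum (Datatypes.S N) t x =
  plus (delay_sum N t x) (dyson (Datatypes.S N) (t - INR (Datatypes.S N) * tau) x).
Proof. unfold delay_sum. exact (sum_Sn _ N). Qed.

Lemma delay_sum_0 t x : delay_sum 0 t x = T t x.
Proof.
unfold delay_sum. rewrite sum_O. simpl. f_equal. ring.
Qed.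

Lemma delay_sum_stable N M t x :
  t <= INR (Datatypes.S N) * tau -> (N <= M)%nat -> delay_sum M t x = delay_sum N t x.
Proof using htau.
intros Ht HNM. induction HNM as [|M HNM IH]; [easy|].
rewrite delay_sum_S, IH, dyson_nonpos; [apply plus_zero_r|].
assert (INR (Datatypes.S N) * tau <= INR (Datatypes.S M) * tau).
{ apply Rmult_le_compat_r; [lra|]. apply le_INR; lia. }
lra.
Qed.

Lemma delay_sum_continuous N x t : continuous (fun t : R => delay_sum N t x) t.
Proof using hT hA.
induction N as [|N IH].
- apply continuous_ext with (f := fun t : R => T t x);
    [|now apply (es_continuous T hT)].
  intros s. symmetry. apply delay_sum_0.
- apply continuous_ext with (f := fun t : R => plus (delay_sum N t x)
    (dyson (Datatypes.S N) (t + - (INR (Datatypes.S N) * tau)) x)).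
  { intros s. symmetry. apply delay_sum_S. }
  apply (continuous_plus (fun t : R => delay_sum N t x)
    (fun t : R => dyson (Datatypes.S N) (t + - (INR (Datatypes.S N) * tau)) x)); [easy|].
  apply (continuous_shift (fun t => dyson (Datatypes.S N) t x)).
  apply dyson_continuous.
Qed.

Lemma shifted_C1 n x y :
  generates T x y ->
  exists d : R -> V, (forall t, continuous d t) /\ forall t, tau <= t ->
    right_deriv (fun s => dyson n (s - INR n * tau) x) t (d t) /\
    generates T (dyson n (t - INR n * tau) x)
      (minus (d t) (match n with
        | O => zero
        | Datatypes.S m => A (dyson m (t - tau - INR m * tau) x) end)).
Proof using hT hA htau.
intros Hxy. destruct (dyson_C1 n x y Hxy) as [d [Hd H]].
set (c := INR n * tau).
exists (fun t => d (Rmax 0 (t - c))). split.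
{ intros t. apply (continuous_shift (fun s => d (Rmax 0 s)) (- c)).
  apply (continuous_on_clamp 0 d). now apply continuous_on_of_continuous. }
intros t Ht.
destruct (Rle_lt_dec c t) as [Hct|Hct].
- rewrite Rmax_right by lra. destruct (H (t - c) ltac:(lra)) as [H1 H2]. split.
  + now apply (right_deriv_shift (fun s => dyson n s x) (- c)).
  + destruct n as [|m]; [exact H2|].
    replace (t - tau - INR m * tau) with (t - c); [exact H2|].
    unfold c. rewrite S_INR. ring.
- rewrite Rmax_left by lra.
  (* As [tau <= t < n tau], the index is at least 2. *)
  destruct n as [|[|m]]; [unfold c in Hct; simpl in Hct; lra..|].
  (* At argument 0 both U_n and U_(n-1) vanish, and the generator sends zero to zero only. The
     clamped derivative is therefore zero before the switching time. *)
  assert (H0 : d 0 = zero).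
  { destruct (H 0 (Rle_refl 0)) as [_ H2]. rewrite 2!dyson_nonpos in H2 by lra.
    apply (generates_unique T _ _ _ (generates_zero T hT)) in H2.
    rewrite (lin_zero A hA) in H2.
    replace (d 0) with (minus (d 0) zero) by module_eq. now symmetry. }
  rewrite H0. split.
  + apply right_deriv_ext with (3 := right_deriv_const zero t) (d := c - t); [lra|].
    intros s Hs. symmetry. apply dyson_nonpos. lra.
  + rewrite 2!dyson_nonpos.
    * rewrite (lin_zero A hA).
      refine (eq_ind _ (generates T zero) (generates_zero T hT) _ _). module_eq.
    * unfold c in Hct. rewrite 2!S_INR in Hct. rewrite S_INR. lra.
    * lra.
Qed.

Lemma delay_sum_C1 N x y :
  generates T x y ->
  exists d : R -> V, (forall t, continuous d t) /\ forall t, tau <= t ->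
    right_deriv (fun s => delay_sum N s x) t (d t) /\
    generates T (delay_sum N t x)
      (minus (d t) (match N with
        | O => zero
        | Datatypes.S M => A (delay_sum M (t - tau) x) end)).
Proof using hT hA htau.
intros Hxy. induction N as [|N [d [Hd IH]]].
- destruct (shifted_C1 0 x y Hxy) as [d [Hd H]]. exists d. split; [easy|].
  intros t Ht. destruct (H t Ht) as [H1 H2]. unfold delay_sum. rewrite sum_O.
  split; [|easy]. apply right_deriv_ext with (3 := H1) (d := 1); [lra|].
  intros s _. now rewrite sum_O.
- destruct (shifted_C1 (Datatypes.S N) x y Hxy) as [d' [Hd' H']].
  exists (fun t => plus (d t) (d' t)). split.
  { intros t. now apply (continuous_plus d d'). }
  intros t Ht. destruct (IH t Ht) as [H1 H2]. destruct (H' t Ht) as [H3 H4]. split.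
  + apply right_deriv_ext with (3 := right_deriv_plus _ _ _ _ _ H1 H3) (d := 1); [lra|].
    intros s _. symmetry. apply delay_sum_S.
  + assert (H5 := generates_plus T hT _ _ _ _ H2 H4).
    rewrite delay_sum_S.
    refine (eq_ind _ (generates T _) H5 _ _).
    destruct N as [|N].
    * unfold delay_sum at 1. rewrite sum_O. module_eq.
    * rewrite delay_sum_S, (lin_plus A hA). module_eq.
Qed.

(** Any cut-off beyond [t / tau] would do, since the later terms vanish at [t]. *)
Definition delay_count (t : R) : nat :=
  proj1_sig (constructive_indefinite_description _ (INR_unbounded (t / tau))).

Lemma delay_count_gt t : t < INR (delay_count t) * tau.
Proof using htau.
unfold delay_count. destruct constructive_indefinite_description as [n Hn]; simpl.
apply Rmult_lt_compat_r with (r := tau) in Hn; [|easy].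
replace (t / tau * tau) with t in Hn by (field; lra). easy.
Qed.

Definition delay_solution (t : R) (x : V) : V :=
  if Rlt_dec t 0 then zero else delay_sum (delay_count t) t x.

Lemma delay_solution_neg t x : t < 0 -> delay_solution t x = zero.
Proof. intros Ht. unfold delay_solution. destruct Rlt_dec; lra || easy. Qed.

Lemma delay_solution_eq N t x :
  0 <= t <= INR (Datatypes.S N) * tau -> delay_solution t x = delay_sum N t x.
Proof using htau.
intros Ht. unfold delay_solution. destruct Rlt_dec as [H|_]; [lra|].
destruct (Nat.le_gt_cases N (delay_count t)) as [H|H].
- now apply delay_sum_stable.
- symmetry. apply delay_sum_stable; [|lia].
  assert (H1 := delay_count_gt t). rewrite S_INR. lra.
Qed.

Lemma delay_horizon t : exists N, t < INR N * tau.
Proof using htau. exists (delay_count t). apply delay_count_gt. Qed.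

Lemma delay_solution_continuous x :
  continuous_on (fun t => 0 <= t) (fun t => delay_solution t x).
Proof using hT hA htau.
apply continuous_on_eps. intros t Ht eps Heps.
destruct (delay_horizon t) as [N HN].
destruct (proj1 (continuous_eps _ _) (delay_sum_continuous N x t) eps Heps)
  as [d [Hd H]].
exists (Rmin d (INR N * tau - t)). split; [apply Rmin_pos; lra|].
intros s Hs Hst.
assert (Hmin := Rmin_l d (INR N * tau - t)).
assert (Hmin' := Rmin_r d (INR N * tau - t)).
assert (Hst' := Rabs_def2 _ _ Hst).
rewrite 2!(delay_solution_eq N) by (rewrite S_INR; lra).
apply H. lra.
Qed.

(* Near every point of [J], [u] is a primitive of [du]; [du] itself may be
   anything outside [J]. *)
Definition C1_within (J : R -> Prop) (u du : R -> V) : Prop :=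
  forall t, J t -> exists w delta, (forall s, continuous w s) /\ 0 < delta /\
    forall s, J s -> Rabs (s - t) < delta ->
      minus (u s) (u t) = RInt w t s /\ du s = w s.

Lemma C1_within_of_right_deriv a b u w t :
  (forall s, continuous u s) -> (forall s, continuous w s) ->
  (forall s, a <= s < b -> right_deriv u s (w s)) ->
  a <= t < b -> forall s, a <= s < b -> minus (u s) (u t) = RInt w t s.
Proof.
intros Hu Hw Hd Ht s Hs. destruct (Rle_lt_dec t s) as [H|H].
- apply minus_eq_RInt; try easy. intros r Hr. apply Hd; lra.
- transitivity (opp (minus (u t) (u s))); [module_eq|].
  rewrite (minus_eq_RInt u w s t); [|lra|easy|easy|intros r Hr; apply Hd; lra].
  apply (opp_RInt_swap w). now apply ex_RInt_cont.
Qed.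

Lemma delay_solution_before x y :
  generates T x y ->
  (forall t, 0 <= t < tau -> generates T (delay_solution t x) (T t y)) /\
  C1_within (fun t => 0 <= t < tau) (fun t => delay_solution t x) (fun t => T t y).
Proof using hT hA htau.
intros Hxy.
assert (H0 : forall t, 0 <= t < tau -> delay_solution t x = T t x).
{ intros t Ht. rewrite (delay_solution_eq 0) by (simpl; lra). apply delay_sum_0. }
split.
- intros t Ht. rewrite H0 by easy. apply generates_orbit; [easy|lra|easy].
- intros t Ht. exists (fun t => T t y), 1.
  split; [intros s; now apply (es_continuous T hT)|]. split; [lra|].
  intros s Hs _. split; [|easy]. rewrite 2!H0 by easy.
  apply (C1_within_of_right_deriv 0 tau (fun t => T t x) (fun t => T t y));
    try easy; try (intros r; now apply (es_continuous T hT)).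
  intros r Hr. apply orbit_right_deriv; [easy|lra|].
  apply generates_orbit; [easy|lra|easy].
Qed.

(** Each partial sum gives a derivative on a bounded interval only. The global [d] is chosen
    pointwise through the generator equation and matched locally with these. *)
Lemma delay_solution_after x y :
  generates T x y ->
  exists d : R -> V,
  (forall t, tau <= t -> generates T (delay_solution t x)
    (minus (d t) (A (delay_solution (t - tau) x)))) /\
  C1_within (fun t => tau <= t) (fun t => delay_solution t x) d.
Proof using hT hA htau.
intros Hxy.
assert (Hloc : forall t, tau <= t -> exists N, t < INR (Datatypes.S N) * tau).
{ intros t _. destruct (delay_horizon t) as [N HN]. exists N. rewrite S_INR. lra. }
(* One term more than [t] requires is kept, so that the index is a successor and [delay_sum N]
   appears as the delayed sum even for [N = 0]. *)
assert (Hsum : forall N t, tau <= t < INR (Datatypes.S N) * tau ->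
  delay_solution t x = delay_sum (Datatypes.S N) t x /\
  delay_solution (t - tau) x = delay_sum N (t - tau) x).
{ intros N t Ht. split; apply delay_solution_eq; rewrite 2?S_INR in *; lra. }
assert (Hd : forall N, exists d : R -> V, (forall t, continuous d t) /\
  forall t, tau <= t < INR (Datatypes.S N) * tau ->
    right_deriv (fun s => delay_sum (Datatypes.S N) s x) t (d t) /\
    generates T (delay_solution t x) (minus (d t) (A (delay_solution (t - tau) x)))).
{ intros N. destruct (delay_sum_C1 (Datatypes.S N) x y Hxy) as [d [Hd H]].
  exists d. split; [easy|]. intros t Ht.
  destruct (Hsum N t Ht) as [-> ->]. apply H; lra. }
assert (Hex : forall t, exists z, tau <= t -> generates T (delay_solution t x)
  (minus z (A (delay_solution (t - tau) x)))).
{ intros t. destruct (Rle_lt_dec tau t) as [Ht|Ht]; [|exists zero; lra].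
  destruct (Hloc t Ht) as [N HN]. destruct (Hd N) as [d [_ H]].
  exists (d t). intros _. apply H; lra. }
set (d := fun t => proj1_sig (constructive_indefinite_description _ (Hex t))).
assert (Hdgen : forall t, tau <= t -> generates T (delay_solution t x)
  (minus (d t) (A (delay_solution (t - tau) x)))).
{ intros t. exact (proj2_sig (constructive_indefinite_description _ (Hex t))). }
exists d. split; [easy|]. clearbody d.
intros t Ht. destruct (Hloc t Ht) as [N HN]. destruct (Hd N) as [w [Hw H]].
exists w, (INR (Datatypes.S N) * tau - t). split; [easy|]. split; [lra|].
intros s Hs Hst. apply Rabs_def2 in Hst. split.
- destruct (Hsum N s ltac:(lra)) as [-> _]. destruct (Hsum N t ltac:(lra)) as [-> _].
  apply (C1_within_of_right_deriv tau (INR (Datatypes.S N) * tau)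
    (fun s => delay_sum (Datatypes.S N) s x) w); try easy; try lra.
  + intros r; apply delay_sum_continuous.
  + intros r Hr. now apply H.
(* [d s] and [w s] yield two generator values at the same vector, which must agree. *)
- assert (Heq := generates_unique T _ _ _ (Hdgen s Hs) (proj2 (H s ltac:(lra)))).
  set (e := A (delay_solution (s - tau) x)) in *.
  replace (d s) with (plus (minus (d s) e) e) by module_eq.
  rewrite Heq. module_eq.
Qed.

(** * Uniqueness for the delay equation *)

Lemma delay_homogeneous_unique u :
  continuous_on (fun t => 0 <= t) u -> (forall t, - tau <= t <= 0 -> u t = zero) ->
  (forall t, 0 <= t -> exists z, generates T (u t) z /\
    right_deriv u t (plus z (A (u (t - tau))))) ->
  forall t, - tau <= t -> u t = zero.
Proof using hT hA htau.
intros Hc H0 H.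
assert (Hk : forall k t, - tau <= t <= INR k * tau -> u t = zero).
{ induction k as [|k IH]; [intros t Ht; simpl in Ht; apply H0; lra|].
  intros b Hb. rewrite S_INR in Hb.
  destruct (Rle_lt_dec b 0) as [Hb0|Hb0]; [apply H0; lra|].
  replace (u b) with (u (Rmax 0 b)) by (now rewrite Rmax_right by lra).
  (* Each step restarts at time 0, where [u] vanishes: the delayed term is already known to be zero
     on all of [[0, b)]. *)
  apply (homogeneous_unique T hT (fun t => u (Rmax 0 t)));
    [now apply continuous_on_clamp|lra|rewrite Rmax_left by lra; apply H0; lra|].
  intros t Ht. destruct (H t (proj1 Ht)) as [z [Hz1 Hz2]]. exists z.
  rewrite Rmax_right by lra. split; [easy|].
  rewrite (IH (t - tau)), (lin_zero A hA), plus_zero_r in Hz2 by lra.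
  apply right_deriv_ext with (3 := Hz2) (d := 1); [lra|].
  intros s Hs. now rewrite Rmax_right by lra. }
intros t Ht. destruct (delay_horizon t) as [k Hkt]. apply (Hk k). lra.
Qed.

Lemma delay_equation_unique u v (z z' : R -> V) :
  continuous_on (fun t => 0 <= t) u -> continuous_on (fun t => 0 <= t) v ->
  (forall t, - tau <= t <= 0 -> u t = v t) ->
  (forall t, 0 <= t -> generates T (u t) (z t) /\
    right_deriv u t (plus (z t) (A (u (t - tau))))) ->
  (forall t, 0 <= t -> generates T (v t) (z' t) /\
    right_deriv v t (plus (z' t) (A (v (t - tau))))) ->
  forall t, - tau <= t -> u t = v t.
Proof using hT hA htau.
intros Hcu Hcv H0 Hu Hv t Ht.
assert (Hz : minus (u t) (v t) = zero).
2:{ replace (u t) with (plus (minus (u t) (v t)) (v t)) by module_eq.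
    rewrite Hz. apply plus_zero_l. }
revert t Ht. apply (delay_homogeneous_unique (fun t => minus (u t) (v t))).
- intros t Ht. apply (filterlim_comp_2 (G := locally (u t)) (H := locally (opp (v t)))
      u (fun t => opp (v t)) plus);
    [now apply Hcu| |exact (@filterlim_plus _ V (u t) (opp (v t)))].
  apply filterlim_comp with (G := locally (v t)); [now apply Hcv|].
  exact (@filterlim_opp _ V (v t)).
- intros t Ht. rewrite (H0 t Ht). module_eq.
- intros t Ht. destruct (Hu t Ht) as [H1 H2]. destruct (Hv t Ht) as [H3 H4].
  exists (minus (z t) (z' t)). split; [now apply generates_minus|].
  refine (eq_ind _ (right_deriv (fun s => minus (u s) (v s)) t)
    (right_deriv_minus _ _ _ _ _ H2 H4) _ _).
  rewrite (lin_minus A hA). module_eq.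
Qed.

End Delay.

Lemma eq_of_eq_on_generator_domain (L L' : V -> V) :
  is_linear L -> is_linear L' ->
  (forall x y, generates T x y -> L x = L' x) -> forall x, L x = L' x.
Proof using hT.
intros HL HL' H x. apply eq_of_norm_le_eps. intros eps Heps.
destruct (linear_norm L HL) as [M [HM HLM]].
destruct (linear_norm L' HL') as [M' [HM' HLM']].
assert (He : 0 < eps / (M + M')) by (apply Rdiv_lt_0_compat; lra).
destruct (generator_dense T hT x _ He) as [z [y [Hzy Hz]]].
replace (minus (L x) (L' x)) with (minus (L' (minus z x)) (L (minus z x))).
2:{ rewrite (lin_minus L HL), (lin_minus L' HL'), (H z y Hzy). module_eq. }
eapply Rle_trans; [apply norm_minus_le|].
apply Rle_trans with (M' * norm (minus z x) + M * norm (minus z x)).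
{ apply Rplus_le_compat; auto. }
apply Rle_trans with ((M + M') * (eps / (M + M'))).
- rewrite <- Rmult_plus_distr_r, Rplus_comm. apply Rmult_le_compat_l; lra.
- right. field. lra.
Qed.

End DysonPhillips.

(** * Right derivatives and Coquelicot's differentials *)

Section Filterdiff.

Context {V : CompleteNormedModule R_AbsRing}.
Implicit Types (u du : R -> V) (J : R -> Prop).

Lemma filterdiff_of_C1_within J u du t :
  C1_within J u du -> J t ->
  filterdiff u (within J (locally t)) (fun h : R => scal h (du t)).
Proof.
intros H Jt. destruct (H t Jt) as [w [d [Hw [Hd Hs]]]].
split; [exact (is_linear_scal_l (du t))|].
intros x Hx.
(* [filterdiff] demands the estimate at every limit of the filter; as [t] lies in [J] and in all of
   its own balls, [t] is the only limit. *)
assert (x = t) as ->.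
{ apply NNPP. intros Hne.
  assert (Hp : 0 < Rabs (t - x)) by (apply Rabs_pos_lt; lra).
  destruct (Hx (fun s => Rabs (s - x) < Rabs (t - x))) as [e He].
  { exists (mkposreal _ Hp). intros s Hs'. exact Hs'. }
  assert (Hlt := He t (ball_center t e) Jt). lra. }
rewrite (proj2 (Hs t Jt ltac:(rewrite Rminus_diag, Rabs_R0; easy))).
intros eps.
destruct (proj1 (continuous_eps _ _) (Hw t) eps (cond_pos eps)) as [d' [Hd' H']].
exists (mkposreal _ (Rmin_pos _ _ Hd Hd')). intros s Hst Js.
change (Rabs (s - t) < Rmin d d') in Hst.
assert (Hmin := Rmin_l d d'). assert (Hmin' := Rmin_r d d').
change (norm (minus (minus (u s) (u t)) (scal (s - t) (w t))) <= eps * Rabs (s - t)).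
rewrite (proj1 (Hs s Js ltac:(lra))).
destruct (Rle_lt_dec t s) as [Hle|Hlt].
- rewrite Rabs_right by lra. rewrite Rabs_right in Hst by lra. rewrite Rmult_comm.
  apply norm_RInt_minus_const_le; [easy|easy|].
  intros r Hr. left. apply H'. apply Rabs_def1; lra.
- rewrite Rabs_left by lra. rewrite Rabs_left in Hst by lra. rewrite Rmult_comm.
  replace (- (s - t)) with (t - s) by ring.
  apply Rle_trans with (norm (minus (RInt w s t) (scal (t - s) (w t)))).
  + rewrite <- (norm_neg (minus (RInt w s t) _)). right. f_equal.
    rewrite <- (opp_RInt_swap w s t) by now apply ex_RInt_cont.
    module_eq.
  + apply norm_RInt_minus_const_le; [easy|lra|].
    intros r Hr. left. apply H'. apply Rabs_def1; lra.
Qed.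

Lemma continuous_on_of_C1_within J u du :
  C1_within J u du -> continuous_on J du.
Proof.
intros H. apply continuous_on_eps. intros t Jt eps Heps.
destruct (H t Jt) as [w [d [Hw [Hd Hs]]]].
destruct (proj1 (continuous_eps _ _) (Hw t) eps Heps) as [d' [Hd' H']].
exists (Rmin d d'). split; [now apply Rmin_pos|]. intros s Js Hst.
assert (Hmin := Rmin_l d d'). assert (Hmin' := Rmin_r d d').
rewrite (proj2 (Hs s Js ltac:(lra))).
rewrite (proj2 (Hs t Jt ltac:(rewrite Rminus_diag, Rabs_R0; easy))).
apply H'. lra.
Qed.

Lemma right_deriv_of_filterdiff J u t (y : V) (b : R) :
  t < b -> (forall s, t <= s < b -> J s) ->
  filterdiff u (within J (locally t)) (fun h : R => scal h y) ->
  right_deriv u t y.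
Proof.
intros Hb HJ [_ H] eps Heps.
destruct (H t) with (eps := mkposreal eps Heps) as [d Hd].
{ intros P [e He]. exists e. intros s Hs _. now apply He. }
exists (Rmin d (b - t)). split; [apply Rmin_pos; [apply cond_pos|lra]|].
intros h Hh.
assert (Hmin := Rmin_l d (b - t)). assert (Hmin' := Rmin_r d (b - t)).
assert (Hball : Rabs (t + h - t) < d) by (apply Rabs_def1; lra).
specialize (Hd (t + h) Hball (HJ (t + h) ltac:(lra))).
change (norm (minus (minus (u (t + h)) (u t)) (scal (t + h - t) y))
  <= eps * Rabs (t + h - t)) in Hd.
replace (t + h - t) with h in Hd by ring. now rewrite Rabs_right in Hd by lra.
Qed.

Lemma right_deriv_of_filterlim u (y : V) :
  filterlim (fun h : R => scal (/ h) (minus (u h) (u 0))) (at_right 0) (locally y) <->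
  right_deriv u 0 y.
Proof.
split.
- intros H eps Heps.
  destruct (proj1 (filterlim_locally_ball_norm (F := at_right 0) _ _) H
    (mkposreal eps Heps)) as [d Hd].
  exists d. split; [apply cond_pos|]. intros h Hh.
  assert (Hb : Rabs (h - 0) < d) by (apply Rabs_def1; lra).
  specialize (Hd h Hb ltac:(lra)).
  change (norm (minus (scal (/ h) (minus (u h) (u 0))) y) < eps) in Hd.
  rewrite Rplus_0_l, (Rmult_comm eps).
  apply Rle_trans with (h * norm (minus (scal (/ h) (minus (u h) (u 0))) y)).
  + rewrite <- norm_scal_pos by lra. right. f_equal. module_eq.
  + apply Rmult_le_compat_l; lra.
- intros H.
  apply (proj2 (filterlim_locally_ball_norm (F := at_right 0)
    (fun h : R => scal (/ h) (minus (u h) (u 0))) y)).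
  intros eps. assert (Heps := cond_pos eps).
  destruct (H (eps / 2) ltac:(lra)) as [d [Hd H1]].
  exists (mkposreal d Hd). intros h Hh Hh0.
  change (Rabs (h - 0) < d) in Hh. apply Rabs_def2 in Hh.
  specialize (H1 h ltac:(lra)). rewrite Rplus_0_l in H1.
  change (norm (minus (scal (/ h) (minus (u h) (u 0))) y) < eps).
  apply Rmult_lt_reg_l with h; [easy|].
  rewrite <- norm_scal_pos by easy.
  apply Rle_lt_trans with (eps / 2 * h).
  + eapply Rle_trans; [|exact H1]. right. f_equal. module_eq.
  + rewrite (Rmult_comm h). apply Rmult_lt_compat_r; lra.
Qed.

End Filterdiff.

(** * Complex scalars *)

Section ComplexScalars.

Variable X : CompleteNormedModule C_AbsRing.

Lemma real_linear (L : X -> X) :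
  is_linear L -> is_linear (U := real_scalars X) (V := real_scalars X) L.
Proof.
intros HL. split.
- exact (linear_plus L HL).
- intros k x. exact (linear_scal L HL (RtoC k) x).
- exact (linear_norm L HL).
Qed.

Lemma real_linear_scal (c : C) :
  is_linear (U := real_scalars X) (V := real_scalars X) (fun x : X => scal c x).
Proof.
apply real_linear. apply (@is_linear_scal_r C_AbsRing X c). intros n m. apply Cmult_comm.
Qed.

Lemma is_linear_fun_plus (f g : X -> X) :
  is_linear f -> is_linear g -> is_linear (fun x => plus (f x) (g x)).
Proof.
intros Hf Hg.
exact (@is_linear_comp C_AbsRing X _ X (fun x => (f x, g x))
  (fun p => plus (fst p) (snd p)) (is_linear_prod f g Hf Hg) is_linear_plus).
Qed.

Variables (T : R -> X -> X) (hT : C0_semigroup T).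

Definition extend (t : R) (x : real_scalars X) : real_scalars X := T (Rmax 0 t) x.

Lemma extend_nonneg t x : 0 <= t -> extend t x = T t x.
Proof. intros Ht. unfold extend. now rewrite Rmax_right. Qed.

Lemma extend_semigroup : extended_semigroup extend.
Proof using hT.
split.
- intros t. apply (real_linear (T (Rmax 0 t))). apply (C0_bounded hT), Rmax_l.
- intros x. rewrite extend_nonneg by lra. apply (C0_zero hT).
- intros s t x Hs Ht. rewrite 3!extend_nonneg by lra. now apply (C0_plus hT).
- intros x t. apply (continuous_on_clamp (V := real_scalars X) 0 (fun t => T t x)).
  apply (C0_continuous hT).
Qed.

Lemma extend_generates (x y : X) :
  right_derivative_at_0 T x y <-> generates extend x y.
Proof using hT.
unfold generates.
rewrite <- (right_deriv_of_filterlim (V := real_scalars X)).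
assert (H : at_right 0 (fun h : R => scal (RtoC (/ h)) (minus (T h x) x) =
  (scal (/ h) (minus (extend h x) (extend 0 x)) : real_scalars X))).
{ exists (mkposreal 1 Rlt_0_1). intros h _ Hh.
  rewrite (extend_nonneg h) by lra. rewrite (es_zero extend extend_semigroup).
  reflexivity. }
split; apply filterlim_ext_loc.
- exact H.
- apply filter_imp with (2 := H). intros h Hh. now symmetry.
Qed.

Variables (A1 : X -> X) (hA1 : is_linear A1) (tau : R) (htau : 0 < tau).

Let V := real_scalars X.
Let hE := extend_semigroup.
Let hA : is_linear (U := V) (V := V) A1 := real_linear A1 hA1.

Let U n r x : V := dyson extend A1 n r x.
Let sol t x : V := delay_solution extend A1 tau t x.

(** The identification of the n-th term is a premise, so the lemma serves both the induction that
    proves it and, afterwards, integrability. *)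
Lemma delay_term_integrand n t x :
  (forall s, INR n * tau <= s -> delay_term tau T A1 n s x = U n (s - INR n * tau) x) ->
  forall s, INR (Datatypes.S n) * tau < s < t ->
    T (t - s) (A1 (delay_term tau T A1 n (s - tau) x)) =
    extend (t - INR (Datatypes.S n) * tau - (s + - (INR (Datatypes.S n) * tau)))
      (A1 (U n (s + - (INR (Datatypes.S n) * tau)) x)).
Proof.
intros IH s Hs. rewrite S_INR in *. rewrite IH by lra.
rewrite <- (extend_nonneg (t - s)) by lra.
f_equal; [ring|]. do 2 f_equal. ring.
Qed.

Lemma delay_term_dyson n t x :
  INR n * tau <= t -> delay_term tau T A1 n t x = U n (t - INR n * tau) x.
Proof using hT hA1.
revert t; induction n as [|n IH]; intros t Ht.
- simpl in Ht. simpl. unfold U. simpl. rewrite extend_nonneg by lra. f_equal. ring.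
- set (c := INR (Datatypes.S n) * tau) in *.
  change (RInt (V := V) (fun s => T (t - s) (A1 (delay_term tau T A1 n (s - tau) x))) c t
    = conv extend (fun q => A1 (U n q x)) (Rmax 0 (t - c))).
  rewrite Rmax_right by lra. unfold conv.
  rewrite (RInt_ext (V := V) _
    (fun s => extend (t - c - (s + - c)) (A1 (U n (s + - c) x)))).
  2:{ intros s Hs. rewrite Rmin_left, Rmax_right in Hs by lra.
      now apply delay_term_integrand. }
  rewrite (RInt_shift (fun s => extend (t - c - s) (A1 (U n s x)))).
  + f_equal; ring.
  + apply continuous_conv_integrand; [exact hE|].
    exact (source_continuous extend hE A1 hA n x).
Qed.

(** [RInt] is total; this existence makes the recursion for [delay_term] one of genuine
    integrals. *)
Lemma ex_RInt_delay_term n t x :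
  INR (Datatypes.S n) * tau <= t ->
  ex_RInt (V := V) (fun s => T (t - s) (A1 (delay_term tau T A1 n (s - tau) x)))
    (INR (Datatypes.S n) * tau) t.
Proof using hT hA1.
intros Ht. set (c := INR (Datatypes.S n) * tau) in *.
apply ex_RInt_ext with
  (fun s => extend (t - c - (s + - c)) (A1 (U n (s + - c) x))).
{ intros s Hs. rewrite Rmin_left, Rmax_right in Hs by lra. symmetry.
  apply delay_term_integrand; [|easy]. intros r Hr. now apply delay_term_dyson. }
apply ex_RInt_cont. intros s.
apply (continuous_shift (fun s => extend (t - c - s) (A1 (U n s x)))).
apply continuous_conv_integrand; [exact hE|].
exact (source_continuous extend hE A1 hA n x).
Qed.

(** Additivity and the bound come from the real theory; complex homogeneity is commutation with
    multiplication by [c]. *)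
Lemma dyson_is_linear n r : is_linear (fun x : X => U n r x : X).
Proof using hT hA1.
split.
- intros x y. exact (dyson_plus extend hE A1 hA n r x y).
- intros c x. symmetry.
  apply (dyson_comm extend hE A1 hA (fun z : X => scal c z)).
  + apply real_linear_scal.
  + intros t z. symmetry.
    apply (linear_scal (T (Rmax 0 t))), (C0_bounded hT), Rmax_l.
  + intros z. symmetry. exact (linear_scal A1 hA1 c z).
- destruct (dyson_bound extend hE A1 hA n (Rabs r)) as [M [HM H]].
  exists M. split; [easy|]. intros x. apply H.
  assert (H1 := Rle_abs r). assert (H2 := Rle_abs (- r)). rewrite Rabs_Ropp in H2. lra.
Qed.

Lemma delay_term_linear n t :
  INR n * tau <= t -> is_linear (delay_term tau T A1 n t).
Proof using hT hA1.
intros Ht. apply is_linear_ext with (2 := dyson_is_linear n (t - INR n * tau)).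
intros x. symmetry. now apply delay_term_dyson.
Qed.

Lemma truncated_delay_term_dyson n t x :
  0 <= t -> truncated_delay_term tau T A1 n t x = U n (t - INR n * tau) x.
Proof using hT hA1.
intros Ht. unfold truncated_delay_term. destruct Rle_dec as [H|H].
- now apply delay_term_dyson.
- destruct n as [|n]; [simpl in H; lra|]. symmetry.
  apply (dyson_nonpos extend A1 n (t - INR (Datatypes.S n) * tau) x). lra.
Qed.

Lemma solution_linear t : is_linear (fun x : X => sol t x : X).
Proof using hT hA1.
unfold sol, delay_solution. destruct Rlt_dec; [exact (@is_linear_zero C_AbsRing X X)|].
induction (delay_count tau t) as [|N IH].
- apply is_linear_ext with (2 := dyson_is_linear 0 (t - INR 0 * tau)).
  intros x. symmetry. unfold delay_sum. exact (sum_O _).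
- apply is_linear_ext with
    (2 := is_linear_fun_plus _ _ IH (dyson_is_linear (Datatypes.S N)
      (t - INR (Datatypes.S N) * tau))).
  intros x. symmetry. exact (delay_sum_S extend A1 tau N t x).
Qed.

(** At fixed [t] the partial sums are eventually equal to the solution, so the error is exactly
    zero. *)
Lemma solution_series t :
  0 <= t ->
  is_operator_series (fun n => truncated_delay_term tau T A1 n t)
    (fun x => sol t x).
Proof using hT hA1 htau.
intros Ht eps. destruct (delay_horizon tau htau t) as [N HN].
exists N. intros n Hn x.
assert (H : sum_n (fun k => truncated_delay_term tau T A1 k t x) n = sol t x).
{ unfold sol. rewrite (delay_solution_eq extend A1 tau htau n t x).
  - apply sum_n_ext. intros k. now apply truncated_delay_term_dyson.
  - split; [easy|]. left. apply Rlt_le_trans with (1 := HN).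
    apply Rmult_le_compat_r; [lra|]. apply le_INR; lia. }
rewrite H. apply Rle_trans with 0.
{ right. exact (norm_minus_self (V := V) (sol t x)). }
apply Rmult_le_pos; [left; apply cond_pos|apply norm_ge_0].
Qed.

Variables (D : X -> Prop) (A0 : X -> X) (hA0 : is_generator T D A0).

Lemma domain_generates x : D x -> generates extend x (A0 x).
Proof using hT hA0. intros Hx. now apply extend_generates, (generator_value hA0). Qed.

Lemma generates_domain x y : generates extend x y -> D x /\ A0 x = y.
Proof using hT hA0.
intros H.
assert (Hx : D x).
{ apply (generator_domain hA0). exists y. now apply extend_generates. }
split; [easy|]. apply (generates_unique extend x); [now apply domain_generates|easy].
Qed.

Lemma C1_on_of_C1_within (J : R -> Prop) (u d du : R -> V) :
  C1_within J u d -> (forall t, J t -> d t = du t) ->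
  C1_on J (u : R -> X) (du : R -> X).
Proof.
intros H Hd.
assert (H' : C1_within J u du).
{ intros t Jt. destruct (H t Jt) as [w [e [Hw [He Hs]]]].
  exists w, e. split; [easy|]. split; [easy|]. intros s Js Hst.
  rewrite <- Hd by easy. now apply Hs. }
split.
- intros t Jt. now apply filterdiff_of_C1_within with (J := J).
- exact (continuous_on_of_C1_within J u du H').
Qed.

Lemma solution_fundamental : is_fundamental_solution tau D A0 A1 sol.
Proof using hT hA1 htau hA0.
assert (Hneg : forall t x, t < 0 -> sol t x = zero)
  by (intros t x Ht; now apply delay_solution_neg).
split.
- intros t _. apply solution_linear.
- intros t x Ht. apply Hneg; lra.
- intros x. unfold sol.
  rewrite (delay_solution_eq extend A1 tau htau 0) by (simpl; lra).
  rewrite delay_sum_0. apply (es_zero extend hE).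
- intros x t Ht. apply filterlim_ext_loc with (f := fun _ => zero).
  + exists (mkposreal 1 Rlt_0_1). intros s _ Hs.
    symmetry. apply Hneg; lra.
  + rewrite (Hneg t x) by lra. apply filterlim_const.
- intros x. exact (delay_solution_continuous extend hE A1 hA tau htau x).
- intros t x Ht Hx. apply domain_generates in Hx.
  destruct (Rlt_le_dec t tau) as [Hlt|Hle].
  + destruct (delay_solution_before extend hE A1 hA tau htau _ _ Hx) as [H _].
    apply (generates_domain _ _ (H t (conj Ht Hlt))).
  + destruct (delay_solution_after extend hE A1 hA tau htau _ _ Hx) as [d [H _]].
    apply (generates_domain _ _ (H t Hle)).
- intros x Hx. apply domain_generates in Hx.
  destruct (delay_solution_before extend hE A1 hA tau htau _ _ Hx) as [H1 H2].
  apply C1_on_of_C1_within with (1 := H2). intros t Ht.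
  assert (He : A0 (sol t x) = _) by exact (proj2 (generates_domain _ _ (H1 t Ht))).
  assert (Hz : A1 (sol (t - tau) x) = zero)
    by (rewrite Hneg by lra; exact (linear_zero A1 hA1)).
  rewrite He, Hz. symmetry. exact (plus_zero_r _).
- intros x Hx. apply domain_generates in Hx.
  destruct (delay_solution_after extend hE A1 hA tau htau _ _ Hx) as [d [H1 H2]].
  apply C1_on_of_C1_within with (1 := H2). intros t Ht.
  assert (He : A0 (sol t x) = _) by exact (proj2 (generates_domain _ _ (H1 t Ht))).
  rewrite He. apply (minus_plus_cancel (V := V)).
Qed.

(** At [t = tau] the second equation applies, so a right derivative exists at every [t >= 0] and the
    kink needs no separate treatment in the uniqueness proof. *)
Lemma fundamental_right_deriv (S : R -> X -> X) (x : X) (t : R) :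
  is_fundamental_solution tau D A0 A1 S -> D x -> 0 <= t ->
  generates extend (S t x) (A0 (S t x)) /\
  right_deriv (V := V) (fun s => S s x) t
    (plus (A0 (S t x) : V) (A1 (S (t - tau) x))).
Proof using hT hA0.
intros HS Hx Ht. split.
{ apply domain_generates. now apply (fs_domain HS). }
destruct (Rlt_le_dec t tau) as [Hlt|Hle].
- apply right_deriv_of_filterdiff with (J := fun t => 0 <= t < tau) (b := tau);
    [easy|intros s Hs; lra|].
  apply (proj1 (fs_equation_before HS Hx)). lra.
- apply right_deriv_of_filterdiff with (J := fun t => tau <= t) (b := t + 1);
    [lra|intros s Hs; lra|].
  apply (proj1 (fs_equation_after HS Hx)). lra.
Qed.

Lemma fundamental_unique (S S' : R -> X -> X) :
  is_fundamental_solution tau D A0 A1 S -> is_fundamental_solution tau D A0 A1 S' ->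
  forall t x, - tau <= t -> S t x = S' t x.
Proof using hT hA1 htau hA0.
intros HS HS' t x Ht. revert x.
apply (eq_of_eq_on_generator_domain extend hE (S t) (S' t)).
- apply real_linear. now apply (fs_bounded HS).
- apply real_linear. now apply (fs_bounded HS').
- intros x y Hxy. destruct (generates_domain _ _ Hxy) as [Hx _]. revert t Ht.
  apply (delay_equation_unique extend hE A1 hA tau htau
    (fun t => S t x) (fun t => S' t x) (fun t => A0 (S t x)) (fun t => A0 (S' t x))).
  + apply (fs_continuous HS).
  + apply (fs_continuous HS').
  + intros t Ht. destruct (Req_dec t 0) as [->|Hne].
    * now rewrite (fs_initial HS), (fs_initial HS').
    * rewrite (fs_history HS) by lra. now rewrite (fs_history HS') by lra.
  + intros t Ht. now apply fundamental_right_deriv.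
  + intros t Ht. now apply fundamental_right_deriv.
Qed.

End ComplexScalars.

Theorem theorem5 (X : CompleteNormedModule C_AbsRing) (tau : R)
  (htau : 0 < tau) (T : R -> X -> X) (hT : C0_semigroup T)
  (D : X -> Prop) (A0 : X -> X) (hA0 : is_generator T D A0)
  (A1 : X -> X) (hA1 : is_linear A1) :
  exists S : R -> X -> X,
    is_fundamental_solution tau D A0 A1 S
    /\ (forall S' : R -> X -> X, is_fundamental_solution tau D A0 A1 S' ->
          forall t x, - tau <= t -> S' t x = S t x)
    /\ (forall n t x, INR (Datatypes.S n) * tau <= t ->
          ex_RInt (V := real_scalars X)
            (fun s => T (t - s) (A1 (delay_term tau T A1 n (s - tau) x)))
            (INR (Datatypes.S n) * tau) t)
    /\ (forall n t, INR n * tau <= t -> is_linear (delay_term tau T A1 n t))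
    /\ (forall t, 0 <= t ->
          is_operator_series (fun n => truncated_delay_term tau T A1 n t) (S t)).
Proof.
exists (delay_solution (V := real_scalars X) (extend X T) A1 tau).
assert (HS := solution_fundamental X T hT A1 hA1 tau htau D A0 hA0).
split; [exact HS|]. split; [|split; [|split]].
- intros S' HS'. now apply (fundamental_unique X T hT A1 hA1 tau htau D A0 hA0).
- intros n t x Ht. now apply ex_RInt_delay_term.
- intros n t Ht. now apply delay_term_linear.
- intros t Ht. now apply solution_series.
Qed.
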